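(* Let $d=3$ and $\gamma>2$. Let $V(t)=(V_1(t),V_2(t),V_3(t))=\tanh(S_t)\,\Theta_{\tau(t)}$ be the relativistic Ornstein–Uhlenbeck velocity process with mass $m=1$, where $S$ is the $(0,+\infty)$-valued diffusion solving $$dS_t=\Bigl(\coth(S_t)-\frac{\gamma}{2}\tanh(S_t)\Bigr)dt+dW_t,$$ $W$ is a standard one-dimensional Wiener process, $\Theta$ is a Wiener process on the unit sphere $S^2\subset\mathbb{R}^3$ independent of $S$, and $\tau(t)=\int_0^t\sinh(S_r)^{-2}\,dr$. Then the cartesian components $V_i$, $i=1,2,3$, have marginal invariant densities $\varphi_{V_i}$ relative to Lebesgue measure given by a symmetric Beta law on $[-1,1]$ with parameter $\gamma/2$; explicitly, $$\varphi_{V_i}(v)=\frac{\Gamma(\gamma)}{2^{\gamma-1}\,\Gamma(\gamma/2)^2}\,(1-v^2)^{\gamma/2-1},\qquad i=1,2,3,\ v\in[-1,1].$$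
   Context: A Wiener process on $S^2$ is a path-continuous Markov process with generator $\frac12$ times the standard Laplace–Beltrami operator of $S^2$. The process $(S_t,\Theta_{\tau(t)})$ on $(0,\infty)\times S^2$ has an invariant probability measure proportional to $\cosh(s)^{-\gamma}\sinh(s)^2\,ds\,d\sigma_{S^2}$, with $d\sigma_{S^2}$ the surface measure of $S^2$; the marginal invariant density of a component is the density of its law when $(S_t,\Theta_{\tau(t)})$ is distributed according to this invariant probability measure. *)

(* Defs.v *)
From HB Require Import structures.
From mathcomp Require Import all_boot all_order all_algebra.
From mathcomp Require Import all_classical all_reals all_analysis.

Set Implicit Arguments.
Unset Strict Implicit.
Unset Printing Implicit Defensive.

Import Order.TTheory GRing.Theory Num.Theory.
Import numFieldNormedType.Exports.

Local Open Scope classical_set_scope.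
Local Open Scope ring_scope.

Definition sinh (R : realType) (x : R) : R := (expR x - expR (- x)) / 2.
Definition cosh (R : realType) (x : R) : R := (expR x + expR (- x)) / 2.
Definition tanh (R : realType) (x : R) : R := sinh x / cosh x.
Definition coth (R : realType) (x : R) : R := cosh x / sinh x.

Definition Gamma (R : realType) (a : R) : R :=
  \int[@lebesgue_measure R]_(x in `]0, +oo[) (x `^ (a - 1) * expR (- x)).

(* [beta_prob] of the library only has natural number parameters. *)
Definition beta_pdf (R : realType) (a b x : R) : R :=
  x `^ (a - 1) * (1 - x) `^ (b - 1) /
  \int[@lebesgue_measure R]_(y in `[0, 1]) (y `^ (a - 1) * (1 - y) `^ (b - 1)).

(* The image of Beta(a, a), which lives on [0, 1], under x |-> 2 x - 1. *)
Definition symmetric_beta_law (R : realType) (a : R) (B : set R) : \bar R :=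
  (\int[@lebesgue_measure R]_(x in `[0%R, 1%R] `&` [set x | B (2 * x - 1)%R])
     (beta_pdf a a x)%:E)%E.

Definition has_law (R : realType) (d d' : measure_display)
    (Omega : measurableType d) (T : measurableType d') (P : probability Omega R)
    (X : Omega -> T) (mu : set T -> \bar R) : Prop :=
  measurable_fun setT X /\
  forall B : set T, measurable B -> P (X @^-1` B) = mu B.

Definition has_density (R : realType) (d : measure_display)
    (Omega : measurableType d) (P : probability Omega R)
    (X : Omega -> R) (f : R -> R) : Prop :=
  [/\ measurable_fun setT f, forall x, 0 <= f x &
      has_law P X (fun B => \int[@lebesgue_measure R]_(x in B) (f x)%:E)%E].

Notation R3 R := (R * R * R)%type.

Definition component (R : realType) (i : 'I_3) (x : R3 R) : R :=
  [:: x.1.1; x.1.2; x.2]`_i.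

Definition basis (R : realType) (i : 'I_3) : R3 R :=
  ((i == 0%N :> nat)%:R, (i == 1%N :> nat)%:R, (i == 2%N :> nat)%:R).

(* The library norm on [R * R * R] is the sup norm. *)
Definition euclidean_norm (R : realType) (x : R3 R) : R :=
  Num.sqrt (\sum_(i < 3) component i x ^+ 2).

Definition sphere (R : realType) : set (R3 R) :=
  [set x | euclidean_norm x = 1].

Definition spherical (R : realType) (phi psi : R) : R3 R :=
  (sin phi * cos psi, sin phi * sin psi, cos phi).

(* [sin phi] is the area element |d_phi x d_psi| of the parametrization
   [spherical] of S^2 by [0, pi] x [0, 2 pi]. *)
Definition surface_measure (R : realType) (A : set (R3 R)) : \bar R :=
  (\int[@lebesgue_measure R]_(phi in `[0%R, pi])
   \int[@lebesgue_measure R]_(psi in `[0%R, (2 * pi)%R])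
     (sin phi * \1_A (spherical phi psi))%:E)%E.

(* Functions on S^2 are represented by functions on R^3 of which only the values
   on S^2 matter, and differentiated through their extension to R^3 \ {0} which
   is constant along rays: the restriction to S^2 of the Euclidean Laplacian of
   that extension is the Laplace-Beltrami operator of the round metric. *)
Definition radial_extension (R : realType) (f : R3 R -> R) (x : R3 R) : R :=
  f ((euclidean_norm x)^-1 *: x).

Definition C2_sphere (R : realType) (f : R3 R -> R) : Prop :=
  let F := radial_extension f in
  forall (x : R3 R), x != 0 -> forall i j : 'I_3,
    [/\ derivable F x (basis R i),
        derivable ('D_(basis R i) F) x (basis R j) &
        {for x, continuous ('D_(basis R j) ('D_(basis R i) F))}].

Definition laplace_beltrami (R : realType) (f : R3 R -> R) (x : R3 R) : R :=
  \sum_(i < 3)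
    'D_(basis R i) ('D_(basis R i) (radial_extension f)) x.

Definition path_continuous (R : realType) (Omega : Type)
    (T : topologicalType) (X : R -> Omega -> T) : Prop :=
  forall w, {within `[0, +oo[, continuous (fun t => X t w)}.

Definition generated_by (R : realType) (d d' : measure_display)
    (Omega : measurableType d) (T : measurableType d')
    (X : R -> Omega -> T) (I : set R) : set (set Omega) :=
  <<s [set A | exists t (B : set T), [/\ I t, measurable B & A = X t @^-1` B]] >>.

Definition independent_processes (R : realType) (d d1 d2 : measure_display)
    (Omega : measurableType d) (T1 : measurableType d1)
    (T2 : measurableType d2) (P : probability Omega R)
    (X : R -> Omega -> T1) (Y : R -> Omega -> T2) : Prop :=
  forall A B : set Omega, generated_by X `[0, +oo[ A ->
    generated_by Y `[0, +oo[ B -> P (A `&` B) = (P A * P B)%E.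

Record is_filtration (R : realType) (d : measure_display)
    (Omega : measurableType d) (F : R -> set (set Omega)) : Prop := {
  filtration_sigma_algebra : forall t, 0 <= t -> sigma_algebra setT (F t) ;
  filtration_measurable : forall t A, 0 <= t -> F t A -> measurable A ;
  filtration_nondecreasing :
    forall s t, 0 <= s -> s <= t -> F s `<=` F t }.

Definition adapted (R : realType) (d d' : measure_display)
    (Omega : measurableType d) (T : measurableType d')
    (F : R -> set (set Omega)) (X : R -> Omega -> T) : Prop :=
  forall t (B : set T), 0 <= t -> measurable B -> F t (X t @^-1` B).

(* [normal_prob m s] has standard deviation s. *)
Record is_wiener (R : realType) (d : measure_display)
    (Omega : measurableType d) (P : probability Omega R)
    (F : R -> set (set Omega)) (W : R -> Omega -> R) : Prop := {
  wiener_adapted : adapted F W ;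
  wiener_continuous : {ae P, forall w,
    {within `[0, +oo[, continuous (fun t => W t w)}} ;
  wiener_start : {ae P, forall w, W 0 w = 0} ;
  wiener_increments : forall s t (A : set Omega) (B : set R),
    0 <= s -> s < t -> F s A -> measurable B ->
    P (A `&` [set w | B (W t w - W s w)]) =
      (P A * normal_prob 0 (Num.sqrt (t - s)) B)%E }.

(* A (0, +oo)-valued weak solution, driven by W, of
   dS = (coth S - gamma / 2 tanh S) dt + dW. Since the noise is
   additive, the equation is read path by path in integrated form. *)
Record is_radial_diffusion (R : realType) (d : measure_display)
    (Omega : measurableType d) (P : probability Omega R) (gamma : R)
    (F : R -> set (set Omega)) (W S : R -> Omega -> R) : Prop := {
  radial_adapted : adapted F S ;
  radial_continuous : path_continuous S ;
  radial_pos : forall t w, 0 <= t -> 0 < S t w ;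
  radial_sde : {ae P, forall w, forall t, 0 <= t ->
    S t w = S 0 w +
      (\int[@lebesgue_measure R]_(r in `[0, t])
        (coth (S r w) - gamma / 2 * tanh (S r w))) + W t w} }.

(* Transition probabilities on S^2, as kernels on R^3 carried by S^2 when
   started on S^2; their values off S^2 are irrelevant. *)
Record is_transition_semigroup (R : realType)
    (p : R -> R.-pker R3 R ~> R3 R) : Prop := {
  semigroup_sphere : forall t x, 0 <= t -> sphere x -> p t x (@sphere R) = 1%E ;
  semigroup_zero : forall x (B : set (R3 R)),
    sphere x -> measurable B -> p 0 x B = \d_x B ;
  semigroup_add : forall s t x (B : set (R3 R)),
    0 <= s -> 0 <= t -> sphere x -> measurable B ->
    p (s + t) x B = (\int[p s x]_(y in @sphere R) p t y B)%E }.

(* The generator, for uniform convergence on S^2, is 1/2 the Laplace-Beltrami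
   operator on the C^2 functions. *)
Definition has_generator_half_laplacian (R : realType)
    (p : R -> R.-pker R3 R ~> R3 R) : Prop :=
  forall f : R3 R -> R, C2_sphere f ->
  forall e : R, 0 < e -> \forall t \near 0^'+, forall x, sphere x ->
    `| ((\int[p t x]_(y in @sphere R) f y) - f x) / t
       - 2^-1 * laplace_beltrami f x | <= e.

Record is_spherical_wiener (R : realType) (d : measure_display)
    (Omega : measurableType d) (P : probability Omega R)
    (Theta : R -> Omega -> R3 R) : Prop := {
  spherical_measurable : forall t, 0 <= t -> measurable_fun setT (Theta t) ;
  spherical_sphere : forall t w, 0 <= t -> sphere (Theta t w) ;
  spherical_continuous : path_continuous Theta ;
  spherical_markov : exists p : R -> R.-pker R3 R ~> R3 R,
    [/\ is_transition_semigroup p, has_generator_half_laplacian p &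
        forall s t (A : set Omega) (B : set (R3 R)),
          0 <= s -> s <= t -> generated_by Theta `[0, s] A -> measurable B ->
          P (A `&` Theta t @^-1` B) =
            (\int[P]_(w in A) p (t - s)%R (Theta s w) B)%E] }.

Definition is_relativistic_OU (R : realType) (d : measure_display)
    (Omega : measurableType d) (P : probability Omega R) (gamma : R)
    (W S : R -> Omega -> R) (Theta : R -> Omega -> R3 R) : Prop :=
  [/\ exists F : R -> set (set Omega),
        [/\ is_filtration F, is_wiener P F W &
            is_radial_diffusion P gamma F W S],
      is_spherical_wiener P Theta &
      independent_processes P S Theta].

Definition clock (R : realType) (Omega : Type)
    (S : R -> Omega -> R) (t : R) (w : Omega) : R :=
  \int[@lebesgue_measure R]_(r in `[0, t]) (sinh (S r w) ^+ 2)^-1.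

Definition state (R : realType) (Omega : Type)
    (S : R -> Omega -> R) (Theta : R -> Omega -> R3 R) (t : R) (w : Omega) :
    R * R3 R :=
  (S t w, Theta (clock S t w) w).

Definition velocity (R : realType) (Omega : Type)
    (S : R -> Omega -> R) (Theta : R -> Omega -> R3 R) (t : R) (w : Omega) :
    R3 R :=
  tanh (S t w) *: Theta (clock S t w) w.

(* cosh(s)^-gamma sinh(s)^2 ds dsigma on (0, +oo) x S^2, evaluated on a set A by
   integrating the surface measure of its sections. *)
Definition invariant_weight (R : realType) (gamma : R) (A : set (R * R3 R)) :
    \bar R :=
  (\int[@lebesgue_measure R]_(s in `]0%R, +oo[)
     ((cosh s `^ (- gamma) * sinh s ^+ 2)%:E
      * surface_measure (xsection A s)))%E.

(* The constant is determined by mu being a probability. That this mu is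
   invariant for the process [state] is a known fact, not part of the
   definition. *)
Definition is_invariant_probability (R : realType) (gamma : R)
    (mu : probability (R * R3 R)%type R) : Prop :=
  exists c : R, 0 < c /\ forall A : set (R * R3 R), measurable A ->
    mu A = (c%:E * invariant_weight gamma A)%E.

(* Main.v *)
(* By Archimedes' theorem, a component of a uniform point of the sphere is uniform
   on [-1, 1], so that under the invariant measure a component of the velocity is
   tanh(s) times a uniform variable, which has density 1{|v| < tanh s} / (2 tanh s).
   Integrating against cosh(s)^-gamma sinh(s)^2 ds leaves the tail integral of
   cosh(s)^(1 - gamma) sinh(s) over tanh s > |v|, that is
   cosh(artanh |v|)^(2 - gamma) / (gamma - 2) = (1 - v^2)^(gamma/2 - 1) / (gamma - 2).
   The constant then follows from B(a, a) = Gamma(a)^2 / Gamma(2 a).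

   Archimedes' theorem has to be proved for each of the three coordinates, as
   [surface_measure] is given in coordinates that single out the third one. For
   the other two, with u = cos phi, the coordinate has for fixed u the arcsine law
   on a section of the unit disc of density (1 - u^2 - z^2)^(-1/2) in (u, z), which
   is symmetric in u and z: integrating in u first gives the constant pi. *)

Require Import Defs.
From HB Require Import structures.
From mathcomp Require Import all_boot all_order all_algebra.
From mathcomp Require Import all_classical all_reals all_analysis.
From mathcomp Require Import measurable_realfun ring lra.

Set Implicit Arguments.
Unset Strict Implicit.
Unset Printing Implicit Defensive.

Import Order.TTheory GRing.Theory Num.Theory.
Import numFieldNormedType.Exports.

Local Open Scope classical_set_scope.
Local Open Scope ring_scope.

Lemma is_derive_mulrl (R : realType) (k x : R) : is_derive x 1 ( *%R k) k.
Proof.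
rewrite -[X in is_derive _ _ _ X]mulr1.
exact: (@is_deriveZ _ _ _ id k x 1 1 (is_derive_id _ _)).
Qed.

(** * Integration against a measure with a density *)

Section density.
Context d (T : measurableType d) (R : realType).
Variable mu : {measure set T -> \bar R}.
Local Open Scope ereal_scope.

(* The hypotheses are arguments of the definition so that the measure structure
   is canonical. *)
Definition density (f : T -> R) & measurable_fun setT f
    & (forall x, 0 <= f x)%R := fun A => \int[mu]_(x in A) (f x)%:E.

Variables (f : T -> R) (mf : measurable_fun setT f).
Hypothesis f0 : forall x, (0 <= f x)%R.

Let density0 : density mf f0 set0 = 0.
Proof. exact: integral_set0. Qed.

Let density_ge0 A : 0 <= density mf f0 A.
Proof. by apply: integral_ge0 => x _; rewrite lee_fin. Qed.

Let density_sigma_additive : semi_sigma_additive (density mf f0).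
Proof.
apply: semi_sigma_additive_nng_induced; first exact/measurable_EFinP.
by move=> x; rewrite lee_fin.
Qed.

HB.instance Definition _ := isMeasure.Build _ _ _ (density mf f0)
  density0 density_ge0 density_sigma_additive.

Import HBNNSimple.

(** By monotone convergence, both sides are limits of the integrals of the simple functions [h_ n];
    for these, linearity leaves level sets, where the claim is the definition of [density]. *)
Lemma ge0_integral_density (h : T -> \bar R) :
  measurable_fun setT h -> (forall x, 0 <= h x) ->
  \int[density mf f0]_x h x = \int[mu]_x (h x * (f x)%:E).
Proof.
move=> mh h0.
pose h_ := nnsfun_approx measurableT mh.
have cvgh x : (h_ n x)%:E @[n --> \oo] --> h x.
  by apply: cvg_nnsfun_approx => // *; exact: h0.
have ndh x : {homo (fun n => (h_ n x)%:E) : n m / (n <= m)%N >-> n <= m}.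
  by move=> n m nm; rewrite lee_fin; exact/lefP/nd_nnsfun_approx.
have mh_ n : measurable_fun setT (fun x => (h_ n x)%:E).
  exact/measurable_EFinP/measurable_funP.
have mfE : measurable_fun setT (EFin \o f) by exact/measurable_EFinP.
transitivity (limn (fun n => \int[density mf f0]_x (h_ n x)%:E)).
  rewrite -monotone_convergence//.
  - by apply: eq_integral => x _; apply/esym/cvg_lim.
  - by move=> n x _; rewrite lee_fin.
have mhf n : measurable_fun setT (fun x => (h_ n x)%:E * (f x)%:E).
  exact: emeasurable_funM.
transitivity (limn (fun n => \int[mu]_x ((h_ n x)%:E * (f x)%:E))); last first.
  rewrite -monotone_convergence//.
  - apply: eq_integral => x _; apply/cvg_lim => //.
    exact: cvgeZr.
  - by move=> n x _; rewrite mule_ge0// lee_fin.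
  - by move=> x _ n m nm; rewrite lee_wpmul2r ?lee_fin// -lee_fin ndh.
apply/congr_lim/funext => n /=.
under [in LHS]eq_integral do rewrite fimfunE -fsumEFin//.
have mk k : measurable_fun setT (fun x => (k * \1_(h_ n @^-1` [set k]) x)%:E).
  exact/measurable_EFinP/measurable_funM.
rewrite ge0_integral_fsum//; last by move=> k x _; rewrite nnfun_muleindic_ge0.
transitivity (\sum_(k \in range (h_ n))
    \int[mu]_x (k * \1_(h_ n @^-1` [set k]) x * f x)%:E).
  apply: eq_fsbigr => k _.
  rewrite integralZl_indic_nnsfun// integral_indic//= setIT.
  rewrite /density integral_mkcond/=.
  (* Pulling out [k] requires [0 <= k]; a negative [k] is not a value of [h_ n], so its level set is
     empty. *)
  have [k0|k0] := ltP k 0%R.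
    have -> : h_ n @^-1` [set k] = set0 by exact: preimage_nnfun0.
    rewrite erestrict_set0 integral0 mule0 integral0_eq// => x _.
    by rewrite indicE in_set0 mulr0 mul0r.
  rewrite -ge0_integralZl_EFin//.
  - apply: eq_integral => x _; rewrite patchE indicE.
    by case: ifPn => _; rewrite ?mulr1 ?mulr0 ?mul0r ?mule0 ?EFinM.
  - by move=> x _; rewrite erestrict_ge0// => ? _; rewrite lee_fin.
  - apply/(measurable_restrictT _ _).1 => //; exact: measurable_funTS.
rewrite -ge0_integral_fsum//.
- apply: eq_integral => x _; rewrite [h_ n x]fimfunE -EFinM.
  by rewrite mulr_fsuml fsumEFin.
- by move=> k; apply/measurable_EFinP/measurable_funM => //; apply: measurable_funM.
- by move=> k x _; rewrite EFinM mule_ge0// ?EFinM ?nnfun_muleindic_ge0// lee_fin.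
Qed.

End density.

(** * Changes of variables on the line for nonnegative measurable functions *)

Section substitution.
Context {R : realType}.
Local Notation mu := (@lebesgue_measure R).

(** The fundamental theorem of calculus, with [a = b] allowed, as it serves for intervals that may
    shrink to a point. *)
Lemma integral_is_derive (F f : R -> R) a b : a <= b ->
  (forall x : R, is_derive x 1 F (f x)) -> continuous f ->
  (\int[mu]_(x in `[a, b]) (f x)%:E = (F b - F a)%:E)%E.
Proof.
move=> + dF cf; rewrite le_eqVlt => /predU1P[<-|ab].
  by rewrite set_itv1 integral_set1 subrr.
have cF : continuous F.
  by move=> x; apply/differentiable_continuous/derivable1_diffP.
rewrite (@continuous_FTC2 _ f F a b ab)//.
- exact: continuous_subspaceT.
- split => //.
  + by apply: cvg_at_right_filter; exact: cF.
  + by apply: cvg_at_left_filter; exact: cF.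
- by move=> x _; rewrite derive1E; apply: derive_val.
Qed.

(** Positivity is asked on the open interval only, since [sin] and [cos] vanish at the ends of
    intervals on which they serve as derivatives. *)
Lemma is_derive_gt0_lt (G g : R -> R) a b :
  (forall x : R, is_derive x 1 G (g x)) ->
  (forall x, a < x < b -> 0 < g x) ->
  {in `[a, b] &, {mono G : x y / x <= y}}.
Proof.
move=> dG g0; apply: le_mono_in; apply: gtr0_derive1_lt_cc.
- by move=> x _.
- move=> x; rewrite in_itv/= => /g0; rewrite derive1E.
  by move: (dG x) => dGx; rewrite derive_val.
- apply: continuous_subspaceT => x.
  by apply/differentiable_continuous/derivable1_diffP.
Qed.

(* Both sides are the integral of h against the image by G of the measure
   g dx on [a, b], which is computed on the half-lines [y, +oo[. *)
Lemma ge0_integral_substitution_increasing (G g : R -> R) a b (h : R -> \bar R) :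
  a < b -> (forall x : R, is_derive x 1 G (g x)) -> continuous g ->
  (forall x, a <= x <= b -> 0 <= g x) -> (forall x, a < x < b -> 0 < g x) ->
  measurable_fun setT h -> (forall x, 0 <= h x)%E ->
  (\int[mu]_(x in `[a, b]) (h (G x) * (g x)%:E) =
   \int[mu]_(y in `[G a, G b]) h y)%E.
Proof.
move=> ab dG cg g_ge0 g0 mh h0.
have cG : continuous G.
  by move=> x; apply/differentiable_continuous/derivable1_diffP.
have mG : measurable_fun setT G by exact: continuous_measurable_fun.
have mg : measurable_fun setT g by exact: continuous_measurable_fun.
have monoG := is_derive_gt0_lt dG g0.
have aab : a \in `[a, b] by rewrite in_itv/= lexx ltW.
have bab : b \in `[a, b] by rewrite in_itv/= lexx ltW.
have Gab : G a < G b by rewrite (leW_mono_in monoG).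
(* [w] is [g] cut off to [[a, b]] and [v] is the indicator of [[G a, G b]]: both sides become
   integrals over the whole line against measures with a density. *)
pose w x := g x * \1_`[a, b] x.
have w0 x : 0 <= w x.
  rewrite /w indicE; case: (boolP (x \in _)) => [|_]; last by rewrite mulr0.
  by rewrite inE/= in_itv/= mulr1; exact: g_ge0.
have mw : measurable_fun setT w.
  exact: measurable_funM.
pose v : R -> R := \1_`[G a, G b].
have v0 x : 0 <= v x by [].
have mv : measurable_fun setT v by exact: measurable_indic.
have wE D : measurable D ->
    (\int[mu]_(x in D) (w x)%:E = \int[mu]_(x in D `&` `[a, b]) (g x)%:E)%E.
  move=> mD; rewrite integral_mkcondr; apply: eq_integral => x _.
  rewrite patchE /w indicE.
  by case: ifPn => _; rewrite ?mulr1 ?mulr0.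
have vE D : measurable D ->
    (\int[mu]_(x in D) (v x)%:E = mu (D `&` `[G a, G b]))%E.
  by move=> mD; rewrite integral_indic// setIC.
have pushE A : measurable A ->
    pushforward (density mu mw w0) G A = density mu mv v0 A.
  unshelve refine (@measure_unique _ R (measurableTypeR R) (@RGenCInfty.G R)
    (fun n => `[(- n%:R)%R, +oo[%classic) _ _ _ _
    (pushforward (density mu mw w0) (G : _ -> measurableTypeR R))
    (density mu mv v0) _ _ A).
  - exact: mG.
  - exact: RGenCInfty.measurableE.
  - move=> _ _ [x ->] [y ->]; exists (Num.max x y).
    by apply/seteqP; split=> z /=; rewrite !in_itv/= !andbT ge_max => /andP.
  - by move=> n; exists (- n%:R).
  - apply/seteqP; split=> // z _; exists (Num.bound `|z|) => //=.
    rewrite in_itv/= andbT lerNl (le_trans (ler_norm _))// normrN.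
    exact/ltW/archi_boundP.
  - move=> _ [y ->].
    have mGy : measurable (G @^-1` `[y, +oo[).
      by rewrite -[X in measurable X]setTI; exact: mG.
    apply: (etrans (wE _ mGy)); apply: (etrans _ (esym (vE _ (measurable_itv _)))).
    have [yGb|Gby] := leP y (G b); last first.
      rewrite (_ : G @^-1` _ `&` _ = set0); last first.
        apply/seteqP; split=> // x [/=]; rewrite !in_itv/= andbT => yGx xab.
        by have := lt_le_trans Gby yGx; rewrite ltNge monoG// (andP xab).2.
      rewrite (_ : `[y, +oo[ `&` _ = set0) ?measure0 ?integral_set0//.
      apply/seteqP; split=> // x [/=]; rewrite !in_itv/= andbT => yx /andP[_ xb].
      by have := lt_le_trans Gby (le_trans yx xb); rewrite ltxx.
    (* The maximum treats at once a [y] below [G a] and a [y] between [G a] and [G b]; the preimage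
       of the half-line within [[a, b]] is then [[c, b]]. *)
    have [c cab yGc] : exists2 c, c \in `[a, b] & (G c = Num.max (G a) y).
      apply: IVT; [exact: ltW|exact: continuous_subspaceT|].
      by rewrite (min_idPl (ltW Gab)) (max_idPr (ltW Gab)) le_max lexx ge_max (ltW Gab).
    have cb : c <= b by move: cab; rewrite in_itv/= => /andP[].
    rewrite (_ : G @^-1` _ `&` _ = `[c, b]%classic); last first.
      apply/seteqP; split=> [x [/=]|x /=]; rewrite !in_itv/= andbT.
        move=> yGx xab; rewrite (andP xab).2 andbT -monoG// yGc ge_max yGx andbT.
        by rewrite monoG// (andP xab).1.
      move=> /andP[cx xb].
      have xab : x \in `[a, b].
        by move: cab; rewrite !in_itv/= xb andbT => /andP[/le_trans-> ].
      by split; [rewrite -monoG// yGc ge_max in cx; case/andP: cx|].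
    rewrite integral_is_derive//.
    rewrite (_ : `[y, +oo[ `&` _ = `[G c, G b]%classic); last first.
      apply/seteqP; split=> [x [/=]|x /=]; rewrite !in_itv/= andbT yGc ge_max.
        by move=> -> /andP[-> ->].
      by move=> /andP[/andP[-> ->] ->].
    rewrite lebesgue_measure_itv/= lte_fin (leW_mono_in monoG)// -EFinB.
    by move: cb; rewrite le_eqVlt => /predU1P[->|->//]; rewrite ltxx subrr.
  (* Finiteness on the exhausting half-lines: the mass is at most [G b - G a]. *)
  - move=> n.
    have mGn : measurable (G @^-1` `[(- n%:R)%R, +oo[).
      by rewrite -[X in measurable X]setTI; exact: mG.
    suff : (\int[mu]_(x in G @^-1` `[(- n%:R)%R, +oo[ `&` `[a, b]) (g x)%:E < +oo)%E.
      by rewrite -(wE _ mGn).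
    apply: (@le_lt_trans _ _ (\int[mu]_(x in `[a, b]) (g x)%:E)%E).
      apply: ge0_subset_integral => //.
      - exact: measurableI.
      - exact/measurable_EFinP/measurable_funTS.
    by rewrite (integral_is_derive (ltW ab) dG cg) ltry.
transitivity (\int[pushforward (density mu mw w0)
    (G : _ -> measurableTypeR R)]_y h y)%E.
  rewrite ge0_integral_pushforward//= ?preimage_setT.
  rewrite ge0_integral_density//; last exact: measurableT_comp.
  rewrite [LHS]integral_mkcond; apply: eq_integral => x _.
  by rewrite patchE /w indicE; case: ifPn => _; rewrite ?mulr1 ?mulr0 ?mule0.
transitivity (\int[density mu mv v0]_y h y)%E.
  by apply: eq_measure_integral => A mA _; exact: pushE.
rewrite ge0_integral_density//.
rewrite [RHS]integral_mkcond; apply: eq_integral => x _.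
by rewrite patchE /v indicE; case: ifPn => _; rewrite ?mule1 ?mule0.
Qed.

Lemma integral_indicM (D : set R) (f : R -> \bar R) :
  (\int[mu]_(x in D) f x = \int[mu]_x ((\1_D x)%:E * f x))%E.
Proof.
rewrite integral_mkcond; apply: eq_integral => x _.
by rewrite patchE indicE; case: ifPn => _; rewrite ?mul1e ?mul0e.
Qed.

Lemma ge0_integral_itv_split (a b c : R) (h : R -> \bar R) : a <= b -> b <= c ->
  measurable_fun setT h -> (forall x, 0 <= h x)%E ->
  (\int[mu]_(x in `[a, c]) h x =
   \int[mu]_(x in `[a, b]) h x + \int[mu]_(x in `[b, c]) h x)%E.
Proof.
move=> ab bc mh h0.
rewrite (@itv_bndbnd_setU _ _ _ (BRight b))//.
rewrite ge0_integral_setU//.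
- by congr (_ + _)%E; apply: integral_itv_obnd_cbnd; exact: measurable_funTS.
- exact: measurable_funTS.
- rewrite disj_set2E; apply/eqP/seteqP; split=> // x [/=].
  by rewrite !in_itv/= => /andP[_ xb] /andP[]; rewrite ltNge xb.
Qed.

Lemma ge0_integral_opp (A : set R) (h : R -> \bar R) :
  measurable A -> measurable_fun setT h -> (forall x, 0 <= h x)%E ->
  (\int[mu]_(x in -%R @^-1` A) h (- x)%R = \int[mu]_(x in A) h x)%E.
Proof.
move=> mA mh h0.
rewrite -[LHS](@ge0_integral_pushforward _ _ (measurableTypeR R)
  (measurableTypeR R) R -%R _ mu A h)//; last exact: measurable_funTS.
by apply: eq_measure_integral => B mB _; exact: lebesgue_measureN.
Qed.

(** The image of Lebesgue measure under the translation gives half-open intervals their length, so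
    it is Lebesgue measure by uniqueness. *)
Lemma ge0_integral_translation (c : R) (h : R -> \bar R) :
  measurable_fun setT h -> (forall x, 0 <= h x)%E ->
  (\int[mu]_x h (x + c)%R = \int[mu]_x h x)%E.
Proof.
move=> mh h0.
have mc : measurable_fun setT (fun x : measurableTypeR R => x + c : measurableTypeR R).
  exact: measurable_funD.
rewrite -[LHS](@ge0_integral_pushforward _ _ (measurableTypeR R)
  (measurableTypeR R) R (+%R ^~ c) mc mu setT h)//.
apply: eq_measure_integral => B mB _; apply/esym.
pose f : measurableTypeR R -> measurableTypeR R := fun x => x + c.
unshelve refine (@lebesgue_measure_unique _ (pushforward mu f) _ B mB).
move=> _ [[a b]] _ <-.
rewrite /= /pushforward (_ : _ @^-1` _ = `](a - c), (b - c)]%classic); last first.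
  by apply/seteqP; split=> x /=; rewrite !in_itv/= ltrBlDr lerBrDr.
by rewrite !lebesgue_measure_itv/= !lte_fin ltrD2r -!EFinB opprB addrA subrK.
Qed.

(** The increasing case applied to [- G] and [h \o -%R], after a reflection of the right-hand
    side. *)
Lemma ge0_integral_substitution_decreasing (G g : R -> R) a b (h : R -> \bar R) :
  a < b -> (forall x : R, is_derive x 1 G (- g x)) -> continuous g ->
  (forall x, a <= x <= b -> 0 <= g x) -> (forall x, a < x < b -> 0 < g x) ->
  measurable_fun setT h -> (forall x, 0 <= h x)%E ->
  (\int[mu]_(x in `[a, b]) (h (G x) * (g x)%:E) =
   \int[mu]_(y in `[G b, G a]) h y)%E.
Proof.
move=> ab dG cg g_ge0 g0 mh h0.
have mhN : measurable_fun setT (h \o -%R) by exact: measurableT_comp.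
rewrite -(@ge0_integral_opp _ h)//.
rewrite opp_preimage_itvbndbnd/=.
have dNG (x : R) : is_derive x 1 (- G) (g x).
  by rewrite -[g x]opprK; apply: is_deriveN.
rewrite -(ge0_integral_substitution_increasing ab dNG)//.
by apply: eq_integral => x _ /=; rewrite opprK.
Qed.

Lemma ge0_integral_scale (k a b : R) (h : R -> \bar R) : 0 < k -> a < b ->
  measurable_fun setT h -> (forall x, 0 <= h x)%E ->
  (\int[mu]_(x in `[a, b]) (h (k * x)%R * k%:E) =
   \int[mu]_(y in `[(k * a)%R, (k * b)%R]) h y)%E.
Proof.
move=> k0 ab mh h0.
rewrite -(@ge0_integral_substitution_increasing ( *%R k) (cst k) a b h ab
  (is_derive_mulrl k))//.
- by move=> x; exact: cst_continuous.
- by move=> x _; exact: ltW.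
Qed.

End substitution.

(** * Archimedes' theorem for the three coordinates on the sphere *)

Section archimedes.
Context {R : realType}.
Local Notation mu := (@lebesgue_measure R).

(** The arcsine law up to the factor [1 / pi]. For [1 <= |c|] the conventions on square roots and
    inverses make it 0. *)
Definition arcsine_density (c : R) : R := (Num.sqrt (1 - c ^+ 2))^-1.

Lemma arcsine_density_ge0 c : 0 <= arcsine_density c.
Proof. by rewrite invr_ge0 sqrtr_ge0. Qed.

Lemma measurable_inv_sqrt : measurable_fun setT (fun x : R => (Num.sqrt x)^-1).
Proof.
rewrite (_ : (fun _ => _) = (fun x : R => x `^ (-1)) \o Num.sqrt); last first.
  by apply/funext => x /=; rewrite powR_inv1.
apply: measurableT_comp; first exact: measurable_powR.
by apply: continuous_measurable_fun => x; exact: sqrt_continuous.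
Qed.

Lemma measurable_arcsine_density : measurable_fun setT arcsine_density.
Proof.
apply: (measurableT_comp measurable_inv_sqrt).
by apply: measurable_funB => //; exact: measurable_funX.
Qed.

(** Since [G ^+ 2 + g ^+ 2 = 1] and [g] is positive inside the interval, the density at [G x] is
    [(g x)^-1], which cancels the Jacobian. *)
Lemma integral_arcsine_increasing (G g : R -> R) a b (h : R -> \bar R) :
  a < b -> (forall x : R, is_derive x 1 G (g x)) -> continuous g ->
  (forall x, G x ^+ 2 + g x ^+ 2 = 1) ->
  (forall x, a <= x <= b -> 0 <= g x) -> (forall x, a < x < b -> 0 < g x) ->
  measurable_fun setT h -> (forall x, 0 <= h x)%E ->
  (\int[mu]_(x in `[a, b]) h (G x) =
   \int[mu]_(y in `[G a, G b]) (h y * (arcsine_density y)%:E))%E.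
Proof.
move=> ab dG cg Gg g_ge0 g0 mh h0.
have cG : continuous G.
  by move=> x; apply/differentiable_continuous/derivable1_diffP.
have mG : measurable_fun setT G by exact: continuous_measurable_fun.
have mg : measurable_fun setT g by exact: continuous_measurable_fun.
have md := measurable_arcsine_density.
rewrite -(@ge0_integral_substitution_increasing _ G g a b
  (fun y => (h y * (arcsine_density y)%:E)%E))//.
(* The cancellation fails where [g] vanishes, possibly at the end points; these are negligible. *)
- rewrite [LHS]integral_itv_bndoo; last exact/measurable_funTS/measurableT_comp.
  rewrite [RHS]integral_itv_bndoo; last first.
    apply/measurable_funTS/emeasurable_funM; last exact/measurable_EFinP.
    apply: (@measurableT_comp _ _ _ _ _ _
      (fun y => (h y * (arcsine_density y)%:E)%E)) => //.
    by apply: emeasurable_funM => //; exact/measurable_EFinP.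
  apply: eq_integral => x; rewrite inE/= in_itv/= => /g0 gx0.
  rewrite /arcsine_density -(Gg x) addrAC subrr add0r sqrtr_sqr gtr0_norm//.
  by rewrite -muleA -EFinM mulVf ?mule1// gt_eqF.
- by apply: emeasurable_funM => //; exact/measurable_EFinP.
- by move=> x; rewrite mule_ge0// lee_fin arcsine_density_ge0.
Qed.

(** Reduced to the increasing case by passing to [- G], as the arcsine density is even. *)
Lemma integral_arcsine_decreasing (G g : R -> R) a b (h : R -> \bar R) :
  a < b -> (forall x : R, is_derive x 1 G (- g x)) -> continuous g ->
  (forall x, G x ^+ 2 + g x ^+ 2 = 1) ->
  (forall x, a <= x <= b -> 0 <= g x) -> (forall x, a < x < b -> 0 < g x) ->
  measurable_fun setT h -> (forall x, 0 <= h x)%E ->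
  (\int[mu]_(x in `[a, b]) h (G x) =
   \int[mu]_(y in `[G b, G a]) (h y * (arcsine_density y)%:E))%E.
Proof.
move=> ab dG cg Gg g_ge0 g0 mh h0.
have md := measurable_arcsine_density.
have dNG (x : R) : is_derive x 1 (- G) (g x).
  by rewrite -[g x]opprK; apply: is_deriveN.
have mhN : measurable_fun setT (h \o -%R) by exact: measurableT_comp.
transitivity (\int[mu]_(x in `[a, b]) (h \o -%R) (- G x)%R)%E.
  by apply: eq_integral => x _ /=; rewrite opprK.
rewrite (@integral_arcsine_increasing (- G) g a b (h \o -%R) ab dNG)//; last 2 first.
- by move=> x; rewrite -(Gg x); congr (_ + _); exact: sqrrN.
- by move=> x; exact: h0.
rewrite -(@ge0_integral_opp _ `[G b, G a])//.
- rewrite opp_preimage_itvbndbnd/=; apply: eq_integral => x _ /=.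
  by rewrite /arcsine_density sqrrN.
- by apply: emeasurable_funM => //; exact/measurable_EFinP.
- by move=> x; rewrite mule_ge0// lee_fin arcsine_density_ge0.
Qed.

Lemma integral_cos_sin (h : R -> \bar R) :
  measurable_fun setT h -> (forall x, 0 <= h x)%E ->
  (\int[mu]_(phi in `[0%R, pi]) (h (cos phi) * (sin phi)%:E) =
   \int[mu]_(z in `[(-1)%R, 1%R]) h z)%E.
Proof.
move=> mh h0.
rewrite (@ge0_integral_substitution_decreasing _ cos sin)// ?cospi ?cos0//.
- exact: pi_gt0.
- exact: continuous_sin.
- exact: sin_ge0_pi.
- exact: sin_gt0_pi.
Qed.

(** [cos] runs through [[-1, 1]] once on [[0, pi]] and once on [[pi, 2 pi]], whence the factor 2. *)
Lemma integral_cos (h : R -> \bar R) :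
  measurable_fun setT h -> (forall x, 0 <= h x)%E ->
  (\int[mu]_(psi in `[0%R, (2 * pi)%R]) h (cos psi) =
   2%:E * \int[mu]_(c in `[(-1)%R, 1%R]) (h c * (arcsine_density c)%:E))%E.
Proof.
move=> mh h0.
have pi0 := pi_gt0 R.
have mhc : measurable_fun setT (fun psi : R => h (cos psi)).
  apply: measurableT_comp => //; apply: continuous_measurable_fun.
  exact: continuous_cos.
rewrite (@ge0_integral_itv_split _ _ pi)//; [|lra|lra].
rewrite (integral_arcsine_decreasing pi0 _ (@continuous_sin R))//; last 3 first.
- by move=> x; exact: cos2Dsin2.
- exact: sin_ge0_pi.
- exact: sin_gt0_pi.
(* On [[pi, 2 pi]] the derivative of [cos] is written as a shifted sine, so that its sign is read
   off on [[0, pi]]. *)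
have sinE x : - sin x = sin (x - pi) :> R.
  by rewrite -[x in LHS](subrK pi) sinDpi opprK.
have dcos (x : R) : is_derive x 1 cos (sin (x - pi)).
  by rewrite -sinE; exact: is_derive_cos.
rewrite (@integral_arcsine_increasing _ (fun x => sin (x - pi)))//.
- rewrite cospi cos0 mulr_natl cos2pi.
  by rewrite -mule2n mule_natl.
- lra.
- move=> x; apply: continuous_comp; last exact: continuous_sin.
  by apply: continuousB => //; exact: cst_continuous.
- by move=> x; rewrite -sinE sqrrN cos2Dsin2.
- by move=> x xp; apply: sin_ge0_pi; lra.
- by move=> x xp; apply: sin_gt0_pi; lra.
Qed.

(** The monotone pieces are cut at [pi / 2] and [3 pi / 2]: the middle one covers [[-1, 1]], and the
    two outer ones together cover it once more. *)
Lemma integral_sin (h : R -> \bar R) :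
  measurable_fun setT h -> (forall x, 0 <= h x)%E ->
  (\int[mu]_(psi in `[0%R, (2 * pi)%R]) h (sin psi) =
   2%:E * \int[mu]_(c in `[(-1)%R, 1%R]) (h c * (arcsine_density c)%:E))%E.
Proof.
move=> mh h0.
have pi0 := pi_gt0 R.
have mhs : measurable_fun setT (fun psi : R => h (sin psi)).
  apply: measurableT_comp => //; apply: continuous_measurable_fun.
  exact: continuous_sin.
have md := measurable_arcsine_density.
have sin32 : sin (3 * pi / 2) = -1 :> R.
  rewrite (_ : 3 * pi / 2 = pi / 2 + pi); last lra.
  by rewrite sinDpi sin_pihalf.
rewrite (@ge0_integral_itv_split _ _ (pi / 2))//; [|lra|lra].
rewrite (@ge0_integral_itv_split _ (pi / 2) (3 * pi / 2))//; [|lra|lra].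
(* Shifts by [pi] and [2 pi] bring the last two pieces into [[- pi / 2, pi / 2]], where [cos] is
   nonnegative. *)
have cosE x : - cos x = cos (x - pi) :> R.
  by rewrite -[x in LHS](subrK pi) cosDpi opprK.
have cosE2 x : cos x = cos (x - 2 * pi) :> R.
  by rewrite -[x in LHS](subrK (2 * pi)) mulr_natl cosD2pi.
rewrite (@integral_arcsine_increasing _ cos)//; first last.
- by move=> x xp; apply: cos_gt0_pihalf; lra.
- by move=> x xp; apply: cos_ge0_pihalf; lra.
- by move=> x; rewrite addrC cos2Dsin2.
- exact: continuous_cos.
- lra.
have dsin (x : R) : is_derive x 1 sin (- cos (x - pi)).
  by rewrite -cosE opprK; exact: is_derive_sin.
rewrite (@integral_arcsine_decreasing sin (fun x => cos (x - pi))
  (pi / 2) (3 * pi / 2) h _ dsin)//; first last.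
- by move=> x xp; apply: cos_gt0_pihalf; lra.
- by move=> x xp; apply: cos_ge0_pihalf; lra.
- by move=> x; rewrite -cosE sqrrN addrC cos2Dsin2.
- move=> x; apply: continuous_comp; last exact: continuous_cos.
  by apply: continuousB => //; exact: cst_continuous.
- lra.
rewrite (@integral_arcsine_increasing _ cos)//; first last.
- by move=> x xp; rewrite cosE2; apply: cos_gt0_pihalf; lra.
- by move=> x xp; rewrite cosE2; apply: cos_ge0_pihalf; lra.
- by move=> x; rewrite addrC cos2Dsin2.
- exact: continuous_cos.
- lra.
rewrite sin0 sin_pihalf sin32 mulr_natl sin2pi.
(* The outer pieces, over [[0, 1]] and [[-1, 0]], are brought together and merged. *)
rewrite addeCA [X in (_ + X)%E]addeC.
rewrite -(@ge0_integral_itv_split _ (-1) 0 1); [|lra|lra|..].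
- by rewrite -mule2n mule_natl.
- by apply: emeasurable_funM => //; exact/measurable_EFinP.
- by move=> x; rewrite mule_ge0// lee_fin arcsine_density_ge0.
Qed.

(** For the constant function 1, [integral_cos] equates [2 * pi] with twice this mass. *)
Lemma integral_arcsine_density :
  (\int[mu]_(c in `[(-1)%R, 1%R]) (arcsine_density c)%:E = pi%:E)%E.
Proof.
have := @integral_cos (cst 1%E) (measurable_cst _) (fun _ => lee01).
under [in RHS]eq_integral do rewrite mul1e.
rewrite integral_cst//= mul1e lebesgue_measure_itv/= lte_fin.
rewrite mulr_gt0 ?pi_gt0// oppr0 addr0 EFinM => H.
rewrite -[LHS]mul1e -[X in X%:E](@mulVf R 2)// EFinM -muleA -H muleA -EFinM.
by rewrite mulVf// ?mul1e ?mul1r.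
Qed.

(* The law of a coordinate on the circle of radius sqrt (1 - u^2), a section of
   the unit disc; the density vanishes off the disc thanks to the conventions
   on square roots and inverses. *)
Lemma integral_arcsine_scale (u : R) (h : R -> \bar R) : u ^+ 2 < 1 ->
  measurable_fun setT h -> (forall x, 0 <= h x)%E ->
  (\int[mu]_(c in `[(-1)%R, 1%R])
      (h (Num.sqrt (1 - u ^+ 2) * c)%R * (arcsine_density c)%:E) =
   \int[mu]_(z in `[(-1)%R, 1%R])
      (h z * ((Num.sqrt (1 - (u ^+ 2 + z ^+ 2)))^-1)%:E))%E.
Proof.
move=> u1 mh h0.
have u2 : 0 < 1 - u ^+ 2 by rewrite subr_gt0.
set r := Num.sqrt (1 - u ^+ 2).
have r0 : 0 < r by rewrite sqrtr_gt0.
have rE : r ^+ 2 = 1 - u ^+ 2 by rewrite sqr_sqrtr// ltW.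
have r1 : r <= 1 by rewrite -sqrtr1 ler_sqrt// gerBl sqr_ge0.
pose k z := (h z * ((Num.sqrt (1 - (u ^+ 2 + z ^+ 2)))^-1)%:E)%E.
have mk : measurable_fun setT k.
  apply: emeasurable_funM => //; apply/measurable_EFinP.
  apply: (measurableT_comp measurable_inv_sqrt).
  apply: measurable_funB => //; exact: measurable_funD.
have k0 z : (0 <= k z)%E by rewrite mule_ge0// lee_fin invr_ge0 sqrtr_ge0.
transitivity (\int[mu]_(z in `[(r * -1)%R, (r * 1)%R]) k z)%E.
  rewrite -ge0_integral_scale//.
  apply: eq_integral => c _; rewrite /k -muleA -EFinM; congr (_ * _%:E)%E.
  rewrite opprD addrA -rE exprMn -[X in X - _]mulr1 -mulrBr sqrtrM ?sqr_ge0//.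
  by rewrite sqrtr_sqr gtr0_norm// invfM mulrAC mulVf ?mul1r ?gt_eqF.
rewrite mulrN1 mulr1.
rewrite [LHS]integral_mkcond [RHS]integral_mkcond; apply: eq_integral => z _.
rewrite !patchE; case: ifPn => zr; case: ifPn => // z1.
  case/negP : z1; move: zr; rewrite !inE/= !in_itv/= => /andP[rz zr].
  by rewrite (le_trans _ rz) ?lerN2// (le_trans zr).
rewrite (_ : Num.sqrt _ = 0) ?invr0 ?mule0//; apply: ler0_sqrtr.
rewrite opprD addrA -rE subr_le0.
move: zr; rewrite notin_setE/= in_itv/= -ler_norml => /negP; rewrite -ltNge.
by move=> /ltW rz; rewrite -(real_normK (num_real z)) ler_pXn2r// nnegrE// ltW.
Qed.

(** Covers the first two coordinates at once: [T] stands for [cos] or [sin] and enters through its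
    law on the circle. After [u = cos phi] and an exchange of integrals, each [z] receives an
    arcsine mass [pi], times the factor 2 of that law. *)
Lemma integral_sphere_coordinate (A : set R) (T : R -> R) : measurable A ->
  measurable_fun setT T ->
  (forall h : R -> \bar R, measurable_fun setT h -> (forall x, 0 <= h x)%E ->
   (\int[mu]_(psi in `[0%R, (2 * pi)%R]) h (T psi) =
    2%:E * \int[mu]_(c in `[(-1)%R, 1%R]) (h c * (arcsine_density c)%:E))%E) ->
  (\int[mu]_(phi in `[0%R, pi]) \int[mu]_(psi in `[0%R, (2 * pi)%R])
     (sin phi * \1_A (sin phi * T psi))%:E =
   (2 * pi)%:E * \int[mu]_(z in `[(-1)%R, 1%R]) (\1_A z)%:E)%E.
Proof.
move=> mA mT HT.
pose I : set R := `[(-1), 1]%classic.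
pose rho (u z : R) : R := (Num.sqrt (1 - (u ^+ 2 + z ^+ 2)))^-1.
have rho0 u z : 0 <= rho u z by rewrite invr_ge0 sqrtr_ge0.
have rhoC u z : rho u z = rho z u by rewrite /rho (addrC (u ^+ 2)).
have mrho : measurable_fun setT
    (fun p : measurableTypeR R * measurableTypeR R => rho p.1 p.2).
  apply: (measurableT_comp measurable_inv_sqrt).
  by apply: measurable_funB => //; apply: measurable_funD;
    apply: measurable_funX.
have mA1 : measurable_fun setT (fun z : R => (\1_A z)%:E : \bar R).
  by apply/measurable_EFinP; exact: measurable_indic.
have mI : measurable_fun setT (fun z : R => (\1_I z)%:E : \bar R).
  by apply/measurable_EFinP; apply: measurable_indic; exact: measurable_itv.
have A0 z : (0 <= (\1_A z)%:E :> \bar R)%E by rewrite lee_fin.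
pose g (p : measurableTypeR R * measurableTypeR R) : \bar R :=
  ((\1_I p.2)%:E * ((\1_A p.2)%:E * (rho p.1 p.2)%:E))%E.
have mg : measurable_fun setT g.
  apply: emeasurable_funM; first exact: (measurableT_comp mI).
  apply: emeasurable_funM; last exact/measurable_EFinP.
  exact: (measurableT_comp mA1).
have g0 p : (0 <= g p)%E by rewrite !mule_ge0// lee_fin.
pose f (p : measurableTypeR R * measurableTypeR R) : \bar R := ((\1_I p.1)%:E * g p)%E.
have mf : measurable_fun setT f.
  apply: emeasurable_funM => //.
  exact: (measurableT_comp mI).
have f0 p : (0 <= f p)%E by rewrite mule_ge0// lee_fin.
(* Where [sin phi] is nonzero, [K (cos phi)] is the integral over [psi] without its factor
   [sin phi]. *)
pose K (u : R) := (2%:E * \int[mu]_z g (u, z))%E.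
have mK : measurable_fun setT K.
  by apply: emeasurable_funM => //; exact: measurable_fun_fubini_tonelli_F.
have K0 u : (0 <= K u)%E.
  by rewrite mule_ge0 ?lee_fin//; exact: integral_ge0.
have ltr1 (u : R) : -1 < u < 1 -> u ^+ 2 < 1.
  by rewrite -ltr_norml => u1; rewrite -(real_normK (num_real u)) expr_lt1.
transitivity (\int[mu]_(phi in `[0%R, pi]) (K (cos phi) * (sin phi)%:E))%E.
  apply: eq_integral => phi; rewrite inE/= in_itv/= => phipi.
  have s0 := sin_ge0_pi phipi.
  pose h (c : R) : \bar R := (\1_A (sin phi * c))%:E.
  have mh : measurable_fun setT h.
    by apply: (measurableT_comp mA1); exact: measurable_funM.
  have hT : measurable_fun setT (fun psi => h (T psi)).
    exact: (measurableT_comp mh).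
  under eq_integral do rewrite EFinM.
  have hTI : measurable_fun `[0, 2 * pi] (fun psi => h (T psi)).
    exact: measurable_funTS.
  rewrite ge0_integralZl_EFin//.
  (* At the poles both sides vanish; elsewhere [cos phi ^+ 2 < 1], as [integral_arcsine_scale]
     requires. *)
  rewrite muleC; have [->|sn0] := eqVneq (sin phi) 0; first by rewrite !mule0.
  congr (_ * _)%E.
  rewrite (HT h)//; last by move=> x; rewrite lee_fin.
  rewrite /K; congr (_ * _)%E.
  have c1 : cos phi ^+ 2 < 1.
    by rewrite cos2sin2 ltrBlDr ltrDl exprn_even_gt0.
  have := integral_arcsine_scale c1 mA1 A0.
  rewrite -sin2cos2 sqrtr_sqr ger0_norm// => ->.
  by rewrite integral_indicM.
rewrite integral_cos_sin//.
rewrite /K ge0_integralZl_EFin//; last 2 first.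
- by move=> u _; exact: integral_ge0.
- exact/measurable_funTS/measurable_fun_fubini_tonelli_F.
rewrite EFinM -muleA; congr (_ * _)%E.
transitivity (\int[mu]_u \int[mu]_z f (u, z))%E.
  rewrite [LHS]integral_indicM; apply: eq_integral => u _.
  rewrite /f/= ge0_integralZl_EFin//.
  exact: (measurableT_comp mg (pair1_measurable u)).
transitivity (\int[mu]_z \int[mu]_u f (u, z))%E.
  exact: (@fubini_tonelli _ _ _ _ R mu mu f mf f0).
(* The end points are discarded in order to have [z ^+ 2 < 1]. *)
transitivity (\int[mu]_(z in `](-1)%R, 1%R[) \int[mu]_u f (u, z))%E.
  rewrite -(@integral_itv_bndoo _ _ _ _ true false); last first.
    apply: measurable_funTS.
    exact: (measurable_fun_fubini_tonelli_G (m1 := mu) f mf f0).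
  rewrite [RHS]integral_indicM; apply: eq_integral => z _.
  rewrite indicE; case: (boolP (z \in _)) => [_|zI]; first by rewrite mul1e.
  rewrite mul0e integral0_eq// => u _.
  by rewrite /f /g/= [\1_I z]indicE (negbTE zI) mul0e mule0.
transitivity (\int[mu]_(z in `](-1)%R, 1%R[) (pi%:E * (\1_A z)%:E))%E.
  apply: eq_integral => z; rewrite inE/= => zI.
  have z1 : z ^+ 2 < 1 by apply: ltr1; move: zI; rewrite in_itv.
  (* By the symmetry of [rho], [z] now plays the part of the fixed variable in
     [integral_arcsine_scale], taken with the constant function 1. *)
  transitivity (\int[mu]_(u in `[(-1)%R, 1%R])
      ((\1_A z)%:E * (rho z u)%:E))%E.
    rewrite [RHS]integral_indicM; apply: eq_integral => u _.
    rewrite /f /g/= [\1_I z]indicE mem_set ?mul1e 1?rhoC//.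
    exact: subset_itv_oo_cc.
  rewrite ge0_integralZl_EFin//; last 2 first.
  - by move=> *; rewrite lee_fin.
  - apply/measurable_funTS/measurable_EFinP.
    exact: (measurableT_comp mrho (pair1_measurable z)).
  rewrite muleC; congr (_ * _)%E.
  have := @integral_arcsine_scale z (cst 1%E) z1 (measurable_cst _) (fun _ => lee01).
  under [in LHS]eq_integral do rewrite mul1e.
  under [in RHS]eq_integral do rewrite mul1e.
  by rewrite integral_arcsine_density => <-.
rewrite ge0_integralZl_EFin//; last 2 first.
- exact: measurable_funTS.
- exact: pi_ge0.
by rewrite -(@integral_itv_bndoo _ _ _ _ true false)//; exact: measurable_funTS.
Qed.

Lemma measurable_component (i : 'I_3) : measurable_fun setT (@component R i).
Proof.
case: i => [[|[|[|//]]]] i3; rewrite /component/=.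
- exact: (measurableT_comp measurable_fst).
- exact: (measurableT_comp measurable_snd).
- exact: measurable_snd.
Qed.

Lemma archimedes (i : 'I_3) (A : set R) : measurable A ->
  (surface_measure [set x | A (component i x)] =
   (2 * pi)%:E * \int[mu]_(z in `[(-1)%R, 1%R]) (\1_A z)%:E)%E.
Proof.
move=> mA; rewrite /surface_measure.
have mcos : measurable_fun setT (@cos R).
  by apply: continuous_measurable_fun; exact: continuous_cos.
have msin : measurable_fun setT (@sin R).
  by apply: continuous_measurable_fun; exact: continuous_sin.
case: i => [[|[|[|//]]]] i3.
- exact: (integral_sphere_coordinate mA mcos integral_cos).
- exact: (integral_sphere_coordinate mA msin integral_sin).
(* The third coordinate [cos phi] does not depend on [psi], whose integral contributes the length
   [2 * pi]. *)
rewrite -integral_cos_sin; last 2 first.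
- by apply/measurable_EFinP; exact: measurable_indic.
- by move=> x; rewrite lee_fin.
have m2 : measurable_fun (`[0%R, pi] : set R)
    (fun phi => (\1_A (cos phi))%:E * (sin phi)%:E)%E.
  apply/measurable_funTS/emeasurable_funM; apply/measurable_EFinP => //.
  by apply: measurableT_comp => //; exact: measurable_indic.
rewrite -ge0_integralZl_EFin//; last 2 first.
- by move=> phi /=; rewrite in_itv/= => /sin_ge0_pi s0; rewrite mule_ge0// lee_fin.
- by rewrite mulr_ge0// pi_ge0.
apply: eq_integral => phi _.
transitivity (\int[mu]_(psi in `[0%R, (2 * pi)%R])
    cst (sin phi * \1_A (cos phi))%:E psi)%E; first by [].
rewrite integral_cst//= lebesgue_measure_itv/= lte_fin.
by rewrite mulr_gt0 ?pi_gt0// oppr0 addr0 -!EFinM; congr _%:E; ring.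
Qed.

End archimedes.

(** * Hyperbolic functions and the tail of the radial weight *)

Section radial.
Context {R : realType}.
Local Notation mu := (@lebesgue_measure R).

Lemma cosh_gt0 (x : R) : 0 < cosh x.
Proof. by rewrite divr_gt0// addr_gt0// expR_gt0. Qed.

Lemma sinh_gt0 (x : R) : 0 < x -> 0 < sinh x.
Proof. by move=> x0; rewrite divr_gt0// subr_gt0 ltr_expR gtrN. Qed.

Lemma is_derive_expRN (x : R) :
  is_derive x 1 (fun y => expR (- y)) (- expR (- x)).
Proof.
rewrite -mulN1r mulrC.
exact: (@is_derive1_comp _ expR -%R x (expR (- x)) (-1)).
Qed.

Lemma is_derive_cosh (x : R) : is_derive x 1 (@cosh R) (sinh x).
Proof.
have := is_derive_expRN x => d2.
have -> : @cosh R = (2^-1 : R) *: (@expR R + (fun y => expR (- y))).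
  by apply/funext => y; rewrite /cosh mulrC.
have -> : sinh x = (2^-1 : R) *: (expR x - expR (- x)) by rewrite /sinh mulrC.
exact: is_deriveZ.
Qed.

Lemma is_derive_sinh (x : R) : is_derive x 1 (@sinh R) (cosh x).
Proof.
have := is_derive_expRN x => d2.
have -> : @sinh R = (2^-1 : R) *: (@expR R - (fun y => expR (- y))).
  by apply/funext => y; rewrite /sinh mulrC.
have -> : cosh x = (2^-1 : R) *: (expR x - - expR (- x)).
  by rewrite /cosh opprK mulrC.
exact: is_deriveZ.
Qed.

Lemma continuous_cosh : continuous (@cosh R).
Proof.
move=> x; apply/differentiable_continuous/derivable1_diffP.
by have [] := is_derive_cosh x.
Qed.

Lemma continuous_sinh : continuous (@sinh R).
Proof.
move=> x; apply/differentiable_continuous/derivable1_diffP.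
by have [] := is_derive_sinh x.
Qed.

Lemma tanh_gt0 (x : R) : 0 < x -> 0 < tanh x.
Proof. by move=> x0; rewrite divr_gt0 ?sinh_gt0 ?cosh_gt0. Qed.

Lemma tanh_lt1 (x : R) : tanh x < 1.
Proof.
rewrite ltr_pdivrMr ?cosh_gt0// mul1r ltr_pM2r//.
by have := expR_gt0 (- x); lra.
Qed.

Lemma continuous_tanh : continuous (@tanh R).
Proof.
move=> x; apply: continuousM; first exact: continuous_sinh.
apply: continuousV; last exact: continuous_cosh.
by rewrite gt_eqF// cosh_gt0.
Qed.

Definition atanh (v : R) := ln ((1 + v) / (1 - v)) / 2.

Lemma atanh_ge0 v : 0 <= v < 1 -> 0 <= atanh v.
Proof.
move=> /andP[v0 v1]; rewrite divr_ge0// ln_ge0// ler_pdivlMr; lra.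
Qed.

(** With [e = expR s], both inequalities amount to [1 + v < (1 - v) * e ^+ 2]. *)
Lemma lt_tanh v s : 0 <= v < 1 -> (v < tanh s) = (atanh v < s).
Proof.
move=> /andP[v0 v1].
have v1' : 0 < 1 - v by lra.
have e0 := expR_gt0 s.
have p : 0 < (1 + v) / (1 - v) by rewrite divr_gt0//; lra.
rewrite [RHS]ltr_pdivrMr// -[RHS]ltr_expR lnK ?posrE// expRM_natr.
rewrite ltr_pdivrMr// ltr_pdivlMr ?cosh_gt0// /sinh /cosh expRN.
set e := expR s in e0 *.
have -> : v * ((e + e^-1) / 2) = (v * (e ^+ 2 + 1)) / (2 * e) by field; rewrite gt_eqF.
have -> : (e - e^-1) / 2 = (e ^+ 2 - 1) / (2 * e) by field; rewrite gt_eqF.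
rewrite ltr_pM2r ?invr_gt0 ?mulr_gt0//; apply/idP/idP; nra.
Qed.

(** For [e = expR (atanh v)] one has [e ^+ 2 = (1 + v) / (1 - v)], so that
    [e ^+ 2 + 2 + (e ^+ 2)^-1] is [4 / (1 - v ^+ 2)]. *)
Lemma cosh_atanh v : 0 <= v < 1 -> cosh (atanh v) ^+ 2 = (1 - v ^+ 2)^-1.
Proof.
move=> /andP[v0 v1].
have p : 0 < (1 + v) / (1 - v) by rewrite divr_gt0; lra.
have : expR (atanh v) ^+ 2 = (1 + v) / (1 - v).
  by rewrite -expRM_natr /atanh divfK// lnK.
rewrite /cosh expRN; have := expR_gt0 (atanh v); set e := expR _ => e0 e2.
have -> : ((e + e^-1) / 2) ^+ 2 = (e ^+ 2 + 2 + (e ^+ 2)^-1) / 4.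
  by field; rewrite gt_eqF.
rewrite e2; field; apply/and3P; split; apply/eqP; nra.
Qed.

Lemma cvgr_expRZ (k : R) : 0 < k -> expR (- (k * x)) @[x --> +oo] --> (0 : R).
Proof.
move=> k0; apply: (cvg_comp ( *%R k) (fun y : R => expR (- y))).
  exact: gt0_cvgMry.
exact: cvgr_expR.
Qed.

(** Squeezed between 0 and a multiple of [expR (- (k * s))], since [expR s / 2 <= cosh s]. *)
Lemma cvg_powR_cosh (k : R) : 0 < k -> cosh s `^ (- k) @[s --> +oo] --> (0 : R).
Proof.
move=> k0.
have h : 2 `^ k * expR (- (k * s)) @[s --> +oo] --> (0 : R).
  by rewrite -(mulr0 (2 `^ k)); apply: cvgMr => //; exact: cvgr_expRZ.
apply: (squeeze_cvgr _ (cvg_cst 0) h); near=> s.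
rewrite powR_ge0/= powRN.
have es : expR s / 2 <= cosh s.
  by rewrite ler_pM2r// lerDl expR_ge0.
apply: (@le_trans _ _ ((expR s / 2) `^ k)^-1).
  rewrite lef_pV2 ?posrE ?powR_gt0 ?cosh_gt0 ?divr_gt0 ?expR_gt0//.
  apply: ge0_ler_powR => //; first exact: ltW.
  - by rewrite nnegrE divr_ge0// expR_ge0.
  - by rewrite nnegrE ltW// cosh_gt0.
have E : 2 `^ k * (expR s / 2) `^ k = expR (k * s).
  by rewrite -powRM ?divr_ge0 ?expR_ge0// mulrC divfK// [k * s]mulrC expRM.
by rewrite expRN -E invfM mulrA divff ?mul1r// gt_eqF// powR_gt0.
Unshelve. all: by end_near. Qed.

Lemma is_derive_powR_cosh (k s : R) :
  is_derive s 1 (fun t => cosh t `^ k) (k * cosh s `^ (k - 1) * sinh s).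
Proof.
exact: (is_derive1_comp (is_derive1_powR k (cosh_gt0 s)) (is_derive_cosh s)).
Qed.

Lemma continuous_powR_cosh (k : R) : continuous (fun t : R => cosh t `^ k).
Proof.
move=> x; apply/differentiable_continuous/derivable1_diffP.
by have [] := is_derive_powR_cosh k x.
Qed.

(** The primitive [F] vanishes at infinity because [2 < gamma]; its value at [atanh v] is given by
    [cosh_atanh]. *)
Lemma integral_radial_tail (gamma v : R) : 2 < gamma -> 0 <= v < 1 ->
  (\int[mu]_(s in `]atanh v, +oo[) (cosh s `^ (1 - gamma) * sinh s)%:E =
   ((1 - v ^+ 2) `^ (gamma / 2 - 1) / (gamma - 2))%:E)%E.
Proof.
move=> g2 v01.
have a0 := atanh_ge0 v01.
have g2' : 0 < gamma - 2 by rewrite subr_gt0.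
pose F : R -> R := (2 - gamma)^-1 *: (fun s : R => cosh s `^ (2 - gamma)).
have dF (s : R) : is_derive s 1 F (cosh s `^ (1 - gamma) * sinh s).
  have -> : cosh s `^ (1 - gamma) * sinh s = (2 - gamma)^-1 *:
      ((2 - gamma) * cosh s `^ (2 - gamma - 1) * sinh s).
    rewrite (_ : 2 - gamma - 1 = 1 - gamma); last by lra.
    by rewrite /GRing.scale/= -mulrA mulKf// lt_eqF// subr_lt0.
  exact/is_deriveZ/is_derive_powR_cosh.
have cf : continuous (fun s : R => cosh s `^ (1 - gamma) * sinh s).
  move=> x; apply: cvgM; first exact: continuous_powR_cosh.
  exact: continuous_sinh.
have cF : continuous F.
  by move=> x; apply/differentiable_continuous/derivable1_diffP; case: (dF x).
rewrite integral_itv_obnd_cbnd; last first.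
  by apply/measurable_EFinP/measurable_funTS; exact: continuous_measurable_fun.
rewrite (@ge0_continuous_FTC2y _ _ F _ 0).
- rewrite sub0e -EFinN; congr _%:E.
  transitivity (- ((2 - gamma)^-1 * cosh (atanh v) `^ (2 - gamma))); first by [].
  have -> : cosh (atanh v) `^ (2 - gamma) = (1 - v ^+ 2) `^ (gamma / 2 - 1).
    rewrite (_ : 2 - gamma = 2%:R * (1 - gamma / 2)); last by lra.
    rewrite powRrM powR_mulrn ?ltW ?cosh_gt0// cosh_atanh//.
    rewrite -(@powR_inv1 _ (1 - v ^+ 2)); last by case/andP: v01 => ? ?; nra.
    by rewrite -powRrM; congr (_ `^ _); lra.
  by rewrite -mulNr -invrN opprB mulrC.
- move=> x ax; rewrite mulr_ge0 ?powR_ge0//.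
  have := le_trans a0 ax; rewrite le_eqVlt => /predU1P[<-|/sinh_gt0/ltW//].
  by rewrite /sinh oppr0 subrr mul0r.
- exact: continuous_subspaceT.
- rewrite -[X in _ --> X](scaler0 _ (2 - gamma)^-1); apply: cvgZl_tmp.
  by rewrite -opprB; exact: cvg_powR_cosh.
- by move=> x _; case: (dF x).
- by apply: cvg_at_right_filter; exact: cF.
- by move=> x _; rewrite derive1E; apply: derive_val.
Qed.

End radial.

(** * Euler's integrals and the relation between them *)

Section gamma_beta.
Context {R : realType}.
Local Notation mu := (@lebesgue_measure R).

(** Values in the extended reals allow Tonelli's theorem before finiteness is known. *)
Definition gamma_integral (a : R) : \bar R :=
  (\int[mu]_(x in `]0%R, +oo[) (x `^ (a - 1) * expR (- x))%:E)%E.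

Definition beta_integral (a b : R) : \bar R :=
  (\int[mu]_(x in `[0%R, 1%R]) (x `^ (a - 1) * (1 - x) `^ (b - 1))%:E)%E.

Lemma measurable_powRf d (T : measurableType d) (f : T -> R) (a : R) :
  measurable_fun setT f -> measurable_fun setT (fun x => f x `^ a).
Proof. by move=> mf; apply: (measurableT_comp (measurable_powR a)). Qed.

Lemma measurable_gamma_integrand (a : R) :
  measurable_fun setT (fun x : R => x `^ (a - 1) * expR (- x)).
Proof.
apply: measurable_funM; first exact: measurable_powR.
by apply: measurableT_comp => //; exact: measurableT_comp.
Qed.

(* Gamma(a) Gamma(b) is the total mass of the convolution of the two
   densities; at t, this convolution is t^(a+b-1) exp(-t) B(a, b). *)
Lemma gamma_integralM (a b : R) :
  (gamma_integral a * gamma_integral b =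
   gamma_integral (a + b) * beta_integral a b)%E.
Proof.
(* The cut-off to positive reals turns the convolution into an integral over the whole line. *)
pose q c (x : R) : R := \1_`]0, +oo[ x * x `^ (c - 1).
have q0 c x : 0 <= q c x by rewrite mulr_ge0// powR_ge0.
have mq c : measurable_fun setT (q c).
  apply: measurable_funM; last exact: measurable_powR.
  exact: measurable_indic.
have me : measurable_fun setT (fun x : R => expR (- x)).
  by apply: measurableT_comp => //; exact: measurableT_comp.
have mqe c : measurable_fun setT (fun x : R => (q c x * expR (- x))%:E).
  by apply/measurable_EFinP/measurable_funM.
have gE c : gamma_integral c = (\int[mu]_x (q c x * expR (- x))%:E)%E.
  rewrite /gamma_integral integral_indicM; apply: eq_integral => x _.
  by rewrite /q -EFinM mulrA.
have g0 c : (0 <= gamma_integral c)%E.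
  by rewrite gE; apply: integral_ge0 => x _; rewrite lee_fin mulr_ge0// expR_ge0.
have qe0 c x : (0 <= (q c x * expR (- x))%:E :> \bar R)%E.
  by rewrite lee_fin mulr_ge0// expR_ge0.
have beta0 : (0 <= beta_integral a b)%E.
  by apply: integral_ge0 => x _; rewrite lee_fin mulr_ge0// powR_ge0.
pose f (p : measurableTypeR R * measurableTypeR R) : \bar R :=
  (expR (- p.2) * (q a p.1 * q b (p.2 - p.1)))%:E.
have mf : measurable_fun setT f.
  apply/measurable_EFinP/measurable_funM.
    by apply: measurableT_comp => //; exact: measurableT_comp.
  apply: measurable_funM; first exact: (measurableT_comp (mq a)).
  by apply: (measurableT_comp (mq b)); exact: measurable_funB.
have f0 p : (0 <= f p)%E by rewrite lee_fin mulr_ge0 ?expR_ge0// mulr_ge0.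
transitivity (\int[mu]_x \int[mu]_t f (x, t))%E.
  rewrite (gE a) -ge0_integralZr//; last exact: mqe.
  apply: eq_integral => x _.
  rewrite (gE b) -ge0_integralZl_EFin//; last 2 first.
  - exact: mqe.
  - by rewrite mulr_ge0// expR_ge0.
  pose k y : \bar R :=
    ((q a x * expR (- x))%:E * (q b y * expR (- y))%:E)%E.
  have mk : measurable_fun setT k by exact: emeasurable_funM.
  have k0 y : (0 <= k y)%E by exact: mule_ge0.
  transitivity (\int[mu]_y k y)%E; first by [].
  (* The translation [y = t - x] makes [t] the sum of the two variables. *)
  rewrite -(ge0_integral_translation (- x) mk k0).
  apply: eq_integral => t _; rewrite /k/f/= -EFinM; congr _%:E.
  rewrite opprB [X in _ = X * _](_ : _ = expR (- x) * expR (x - t)); last first.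
    by rewrite -expRD; congr expR; ring.
  by ring.
transitivity (\int[mu]_t \int[mu]_x f (x, t))%E.
  exact: (@fubini_tonelli _ _ _ _ R mu mu f mf f0).
rewrite gE -ge0_integralZr//; last exact: mqe.
apply: eq_integral => t _.
have qab0 x : 0 <= q a x * q b (t - x) by exact: mulr_ge0.
have mqab : measurable_fun setT (fun x : R => (q a x * q b (t - x))%:E : \bar R).
  apply/measurable_EFinP/measurable_funM => //.
  by apply: (measurableT_comp (mq b)); exact: measurable_funB.
rewrite /f/=.
under eq_integral do rewrite EFinM.
rewrite ge0_integralZl_EFin//; last by move=> x _; rewrite lee_fin.
rewrite EFinM (muleC (q (a + b) t)%:E) -muleA; congr (_ * _)%E.
have inI (y : R) : (y \in `]0, +oo[%classic) = (0 < y).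
  by apply/idP/idP; rewrite inE/= in_itv/= andbT.
(* For [t <= 0] no [x] satisfies [0 < x < t], and both sides vanish. *)
have [t0|t0] := leP t 0.
  rewrite [q (a + b) t]/q indicE inI ltNge t0 mul0r mul0e integral0_eq// => x _.
  rewrite /q !indicE !inI subr_gt0; have [x0|x0] := ltP 0 x.
    by rewrite ltNge (le_trans t0 (ltW x0)) mul0r mulr0.
  by rewrite !mul0r.
pose h (x : R) : \bar R := (x `^ (a - 1) * (t - x) `^ (b - 1))%:E.
have mh : measurable_fun setT h.
  apply/measurable_EFinP/measurable_funM; apply: measurable_powRf => //.
  exact: measurable_funB.
have h0 x : (0 <= h x)%E by rewrite lee_fin mulr_ge0// powR_ge0.
(* The bounds 0 and [t] are written as multiples of [t] for the scaling [x = t * u]. *)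
transitivity (\int[mu]_(x in `[(t * 0)%R, (t * 1)%R]) h x)%E.
  rewrite integral_itv_bndoo; last exact: measurable_funTS.
  rewrite [RHS]integral_indicM; apply: eq_integral => x _.
  rewrite /q /h !indicE !inI subr_gt0 -EFinM mulr0 mulr1; congr _%:E.
  have -> : (x \in `]0, t[%classic) = (0 < x) && (x < t).
    by apply/idP/idP; rewrite inE/= in_itv.
  by case: (0 < x); case: (x < t); rewrite ?mul1r ?mul0r ?mulr0.
rewrite -(@ge0_integral_scale _ t 0 1 h)//.
rewrite -ge0_integralZl_EFin//; last 2 first.
- by move=> x _; rewrite lee_fin mulr_ge0// powR_ge0.
- apply: measurable_funTS; apply/measurable_EFinP/measurable_funM;
    apply: measurable_powRf => //; exact: measurable_funB.
apply: eq_integral => u; rewrite inE/= in_itv/= => /andP[u0 u1].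
rewrite /h /q indicE inI t0 mul1r -!EFinM; congr _%:E.
rewrite (_ : t - t * u = t * (1 - u)); last by ring.
rewrite !powRM ?subr_ge0// ?ltW//.
rewrite -[X in _ * X = _](powRr1 (ltW t0)).
(* The final [+ 1] in the exponent of [t] accounts for the Jacobian of the scaling. *)
rewrite (_ : a + b - 1 = (a - 1) + (b - 1) + 1); last by ring.
have tn : t != 0 by rewrite gt_eqF.
rewrite (@powRD _ t (a - 1 + (b - 1)) 1) ?tn ?implybT//.
by rewrite (@powRD _ t (a - 1) (b - 1)) ?tn ?implybT//; ring.
Qed.

(** Half of the exponential decay absorbs the power, which leaves the integrable bound [C * e x]. *)
Lemma gamma_integral_lty (a : R) : 1 < a -> (gamma_integral a < +oo)%E.
Proof.
move=> a1; pose p := a - 1.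
have p0 : 0 < p by rewrite subr_gt0.
have p2 : 0 < 2 * p by rewrite mulr_gt0.
(* The constant comes from [ln y <= y] at [y = x / (2 * p)], which bounds the power [p] of [y] by
   [expR (x / 2)]. *)
pose C := (2 * p) `^ p.
have C0 : 0 <= C by exact: powR_ge0.
pose e (x : R) : R := expR (- (2^-1 * x)).
have de (x : R) : is_derive x 1 e (expR (- (2^-1 * x)) * - 2^-1).
  have d2 : is_derive x 1 (fun x : R => - (2^-1 * x)) (- 2^-1).
    exact: (is_deriveN (is_derive_mulrl 2^-1 x)).
  exact: (@is_derive1_comp _ expR (fun x => - (2^-1 * x))).
have ce : continuous e.
  by move=> x; apply/differentiable_continuous/derivable1_diffP; case: (de x).
have me : measurable_fun setT e by exact: continuous_measurable_fun.
have bound x : 0 < x -> x `^ p * expR (- x) <= C * e x.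
  move=> x0; have y0 : 0 < x / (2 * p) by rewrite divr_gt0.
  have -> : x `^ p = C * (x / (2 * p)) `^ p.
    by rewrite -powRM ?ltW// mulrC divfK// gt_eqF.
  rewrite -mulrA ler_wpM2l//.
  have -> : e x = expR (x / 2) * expR (- x) by rewrite -expRD; congr expR; lra.
  rewrite ler_wpM2r ?expR_ge0// /powR gt_eqF// ler_expR.
  rewrite (_ : x / 2 = p * (x / (2 * p))); last by field; rewrite gt_eqF.
  by rewrite ler_wpM2l ?ltW// ln_sublinear.
have eI : (\int[mu]_(x in `[0%R, +oo[) (e x)%:E = 2%:E)%E.
  pose F : R -> R := (- 2 : R) *: e.
  have dF (x : R) : is_derive x 1 F (e x).
    rewrite (_ : e x = - 2 *: (expR (- (2^-1 * x)) * - 2^-1)).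
      exact: is_deriveZ.
    by rewrite /e /GRing.scale/=; field.
  have cF : continuous F.
    by move=> x; apply/differentiable_continuous/derivable1_diffP; case: (dF x).
  rewrite (@ge0_continuous_FTC2y _ _ F _ 0).
  - have -> : F 0 = -2 * e 0 by [].
    by rewrite sub0e -EFinN /e mulr0 oppr0 expR0 mulr1 opprK.
  - by move=> x _; exact: expR_ge0.
  - exact: continuous_subspaceT.
  - rewrite -[X in _ --> X](scaler0 _ (- 2 : R)); apply: cvgZl_tmp.
    exact: cvgr_expRZ.
  - by move=> x _; case: (dF x).
  - by apply: cvg_at_right_filter; exact: cF.
  - by move=> x _; rewrite derive1E; apply: derive_val.
apply: (@le_lt_trans _ _ (\int[mu]_(x in `]0%R, +oo[) (C%:E * (e x)%:E))%E).
  apply: ge0_le_integral => //.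
  - by move=> x _; rewrite lee_fin mulr_ge0 ?powR_ge0 ?expR_ge0.
  - apply: measurable_funTS; apply/measurable_EFinP.
    exact: measurable_gamma_integrand.
  - apply: measurable_funTS; apply: emeasurable_funM => //.
    exact/measurable_EFinP.
  - by move=> x /=; rewrite in_itv/= andbT => /bound; rewrite -EFinM lee_fin.
rewrite ge0_integralZl_EFin//.
- rewrite integral_itv_obnd_cbnd; first by rewrite eI -EFinM ltry.
  by apply: measurable_funTS; apply/measurable_EFinP.
- by move=> x _; rewrite lee_fin expR_ge0.
- by apply: measurable_funTS; apply/measurable_EFinP.
Qed.

(** On [[1, 2]] the integrand is at least [expR (- 2)]. *)
Lemma gamma_integral_gt0 (a : R) : 1 < a -> (0 < gamma_integral a)%E.
Proof.
move=> a1.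
apply: (@lt_le_trans _ _ (\int[mu]_(x in `[1%R, 2%R]) (expR (- 2))%:E)%E).
  rewrite integral_cst//= lebesgue_measure_itv/= lte_fin ltr1n.
  rewrite -EFinB -EFinM lte_fin mulr_gt0 ?expR_gt0// subr_gt0 ltr1n.
apply: (@le_trans _ _ (\int[mu]_(x in `[1%R, 2%R])
    (x `^ (a - 1) * expR (- x))%:E)%E).
  apply: ge0_le_integral => //.
  - by apply: measurable_funTS; apply/measurable_EFinP;
      exact: measurable_gamma_integrand.
  - move=> x /=; rewrite in_itv/= lee_fin => /andP[x1 x2].
    rewrite -[X in X <= _]mul1r ler_pM ?expR_ge0 ?ler_expR ?lerN2//.
    by rewrite -[X in X <= _](powRr0 x) ler_powR// subr_ge0 ltW.
apply: ge0_subset_integral => //.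
- by apply: measurable_funTS; apply/measurable_EFinP;
    exact: measurable_gamma_integrand.
- by move=> x _; rewrite lee_fin mulr_ge0 ?powR_ge0 ?expR_ge0.
- move=> x /=; rewrite !in_itv/= andbT => /andP[x1 _].
  exact: lt_le_trans x1.
Qed.

End gamma_beta.

(** * The image of the invariant weight under a velocity component *)

Section velocity_law.
Context {R : realType}.
Local Notation mu := (@lebesgue_measure R).

Lemma measurable_velocity (i : 'I_3) :
  measurable_fun setT (fun p : R * R3 R => tanh p.1 * component i p.2).
Proof.
apply: measurable_funM.
  apply: (@measurableT_comp _ _ _ _ _ _ (@tanh R)) => //.
  by apply: continuous_measurable_fun; exact: continuous_tanh.
exact: (measurableT_comp (measurable_component i)).
Qed.

Definition velocity_weight (gamma v : R) : R :=
  if -1 <= v <= 1 then (1 - v ^+ 2) `^ (gamma / 2 - 1) else 0.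

Lemma velocity_weight_ge0 gamma v : 0 <= velocity_weight gamma v.
Proof. by rewrite /velocity_weight; case: ifP => // _; exact: powR_ge0. Qed.

Lemma measurable_velocity_weight gamma :
  measurable_fun setT (velocity_weight gamma).
Proof.
rewrite /velocity_weight; apply: measurable_fun_ifT.
- by apply: measurable_and; apply: measurable_fun_ler.
- by apply: measurable_powRf; apply: measurable_funB => //; exact: measurable_funX.
- exact: measurable_cst.
Qed.

(** Archimedes' theorem followed by the scaling [v = tanh s * z]; the factor [tanh s] on the left is
    its Jacobian. *)
Lemma surface_measure_velocity (i : 'I_3) (B : set R) (s : R) :
  measurable B -> 0 < s ->
  ((tanh s)%:E * surface_measure [set x | B (tanh s * component i x)%R] =
   (2 * pi)%:E *
   \int[mu]_v ((if `|v| < tanh s then 1 else 0) * \1_B v)%:E)%E.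
Proof.
move=> mB s0; have t0 := tanh_gt0 s0; set t := tanh s in t0 *.
have mt : measurable_fun setT ( *%R t) by exact: measurable_funM.
have mBt : measurable ([set z | B (t * z)] : set R).
  by rewrite -[X in measurable X]setTI; exact: mt.
have m1 : measurable_fun setT (fun v : R => (\1_B v)%:E : \bar R).
  by apply/measurable_EFinP; exact: measurable_indic.
rewrite (@archimedes _ i [set z | B (t * z)])// muleCA; congr (_ * _)%E.
transitivity (\int[mu]_(z in `[(-1)%R, 1%R]) ((\1_B (t * z)%R)%:E * t%:E))%E.
  rewrite -ge0_integralZl_EFin//; last 2 first.
  - apply: measurable_funTS; exact: (measurableT_comp m1).
  - exact: ltW.
  by apply: eq_integral => z _; rewrite muleC.
rewrite (ge0_integral_scale t0 _ m1)//.
rewrite mulrN1 mulr1 integral_itv_bndoo; last exact: measurable_funTS.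
rewrite integral_indicM; apply: eq_integral => v _.
rewrite -EFinM; congr (_ * _)%:E; rewrite indicE ltr_norml.
have -> : (v \in `](- t), t[%classic) = (- t < v < t).
  by apply/idP/idP; rewrite inE/= in_itv.
by case: ifP.
Qed.

(** Tonelli's theorem on the region [|v| < tanh s]: for fixed [v], the integral in [s] is the one of
    [integral_radial_tail] at [|v|]. *)
Lemma invariant_weight_velocity (gamma : R) (i : 'I_3) (B : set R) :
  2 < gamma -> measurable B ->
  (invariant_weight gamma [set p | B (tanh p.1 * component i p.2)%R] =
   (2 * pi / (gamma - 2))%:E *
   \int[mu]_(v in B) (velocity_weight gamma v)%:E)%E.
Proof.
move=> g2 mB.
(* The radial weight divided by the [tanh s] of [surface_measure_velocity], times [2 * pi]. *)
pose k (s : R) : R := 2 * pi * (cosh s `^ (1 - gamma) * sinh s).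
have mk : measurable_fun setT k.
  apply: measurable_funM => //; apply: measurable_funM.
    by apply: continuous_measurable_fun; exact: continuous_powR_cosh.
  by apply: continuous_measurable_fun; exact: continuous_sinh.
have k0 s : 0 < s -> 0 <= k s.
  move=> s0; apply: mulr_ge0; first by rewrite mulr_ge0// pi_ge0.
  apply: mulr_ge0; [exact: powR_ge0|exact/ltW/sinh_gt0].
pose below (p : measurableTypeR R * measurableTypeR R) : R :=
  if `|p.2| < tanh p.1 then 1 else 0.
have mbelow : measurable_fun setT below.
  apply: measurable_fun_ifT => //; apply: measurable_fun_ltr.
    exact: measurableT_comp.
  apply: (@measurableT_comp _ _ _ _ _ _ (@tanh R)) => //.
  by apply: continuous_measurable_fun; exact: continuous_tanh.
have below0 p : 0 <= below p by rewrite /below; case: ifP.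
have m1 : measurable_fun setT (\1_B : R -> R) by exact: measurable_indic.
have mk1 : measurable_fun setT (fun s : R => \1_`]0, +oo[ s * k s).
  by apply: measurable_funM => //; exact: measurable_indic.
have k10 s : 0 <= \1_`]0, +oo[ s * k s.
  rewrite indicE; case: (boolP (s \in _)); last by rewrite mul0r.
  by rewrite inE/= in_itv/= andbT mul1r => /k0.
pose f (p : measurableTypeR R * measurableTypeR R) : \bar R :=
  ((\1_`]0, +oo[ p.1 * k p.1)%:E * (below p * \1_B p.2)%:E)%E.
have mf : measurable_fun setT f.
  apply: emeasurable_funM; apply/measurable_EFinP.
    exact: (measurableT_comp mk1).
  by apply: measurable_funM => //; exact: (measurableT_comp m1).
have f0 p : (0 <= f p)%E by rewrite mule_ge0// lee_fin// mulr_ge0.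
transitivity (\int[mu]_s \int[mu]_v f (s, v))%E.
  rewrite /invariant_weight [LHS]integral_indicM; apply: eq_integral => s _.
  rewrite /f /= ge0_integralZl_EFin//; last 2 first.
  - by move=> v _; rewrite lee_fin mulr_ge0.
  - apply/measurable_EFinP/measurable_funM => //.
    exact: (measurableT_comp mbelow (pair1_measurable s)).
  rewrite (EFinM (\1_`]0, +oo[ s)) -muleA indicE.
  case: (boolP (s \in _)); last by rewrite !mul0e.
  rewrite inE/= in_itv/= andbT => s0; congr (_ * _)%E.
  have -> : xsection [set p | B (tanh p.1 * component i p.2)] s =
      [set x | B (tanh s * component i x)].
    by apply/seteqP; split=> x; rewrite /xsection/= inE.
  have c0 := cosh_gt0 s; have h0 := sinh_gt0 s0.
  set w := cosh s `^ (- gamma) * sinh s ^+ 2.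
  have kE : k s = w / tanh s * (2 * pi).
    rewrite /k /w /tanh powRD; last by rewrite (gt_eqF c0) implybT.
    by rewrite powRr1 ?ltW//; field; rewrite !gt_eqF.
  transitivity ((w / tanh s)%:E * ((tanh s)%:E *
      surface_measure [set x | B (tanh s * component i x)%R]))%E.
    by rewrite muleA -EFinM divfK// gt_eqF// tanh_gt0.
  by rewrite surface_measure_velocity// kE (EFinM (w / tanh s)) -muleA.
transitivity (\int[mu]_v \int[mu]_s f (s, v))%E.
  exact: (@fubini_tonelli _ _ _ _ R mu mu f mf f0).
have mw := measurable_velocity_weight gamma.
have w0 := velocity_weight_ge0 gamma.
rewrite -ge0_integralZl_EFin//; last 3 first.
- by move=> v _; rewrite lee_fin.
- by apply: measurable_funTS; exact/measurable_EFinP.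
- by rewrite divr_ge0 ?mulr_ge0 ?pi_ge0// subr_ge0 ltW.
rewrite [RHS]integral_indicM; apply: eq_integral => v _.
pose tail := (\int[mu]_s ((\1_`]0, +oo[ s * k s)%:E * (below (s, v))%:E))%E.
transitivity ((\1_B v)%:E * tail)%E.
  rewrite -ge0_integralZl_EFin//; last 2 first.
  - by move=> s _; rewrite mule_ge0 ?lee_fin.
  - apply: emeasurable_funM; apply/measurable_EFinP => //.
    exact: (measurableT_comp mbelow (pair2_measurable v)).
  by apply: eq_integral => s _; rewrite /f/= (EFinM (below (s, v))) muleA muleC.
congr (_ * _)%E; rewrite {}/tail /velocity_weight.
(* For [1 <= |v|] no [s] contributes, as [tanh s < 1]; the weight vanishes too, at [|v| = 1] because
   its exponent is positive. *)
have [v1|v1] := ltP `|v| 1; last first.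
  rewrite [RHS](_ : _ = 0%E); last first.
    case: ifP => [|_]; last by rewrite mule0.
    rewrite -ler_norml => v1'; have -> : v ^+ 2 = 1.
      by rewrite -(real_normK (num_real v)) (le_anti (introT andP (conj v1' v1))) expr1n.
    by rewrite subrr powR0 ?mule0// gt_eqF// subr_gt0 ltr_pdivlMr// mul1r.
  rewrite integral0_eq// => s _; rewrite /below/= ifF ?mule0//.
  by apply/negbTE; rewrite -leNgt (le_trans _ v1)// ltW// tanh_lt1.
rewrite -ler_norml ltW//.
have v01 : 0 <= `|v| < 1 by rewrite normr_ge0.
(* [integral_radial_tail] takes a nonnegative argument, hence the passage from [v] to [|v|] inside
   the square. *)
rewrite -(real_normK (num_real v)); set Y := powR _ _.
have -> : ((2 * pi / (gamma - 2))%:E * Y%:E =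
    (2 * pi)%:E * (Y / (gamma - 2))%:E)%E.
  by rewrite -!EFinM; congr _%:E; ring.
rewrite -integral_radial_tail// -ge0_integralZl_EFin//; last 3 first.
- move=> s /=; rewrite in_itv/= andbT => /(le_lt_trans (atanh_ge0 v01)) s0.
  rewrite lee_fin; apply: mulr_ge0; first exact: powR_ge0.
  exact/ltW/sinh_gt0.
- apply: measurable_funTS; apply/measurable_EFinP; apply: measurable_funM.
    by apply: continuous_measurable_fun; exact: continuous_powR_cosh.
  by apply: continuous_measurable_fun; exact: continuous_sinh.
- by rewrite mulr_ge0 ?pi_ge0.
rewrite [RHS]integral_indicM; apply: eq_integral => s _.
rewrite -!EFinM /below/= lt_tanh//; congr _%:E; rewrite !indicE.
have inI (c y : R) : (y \in `]c, +oo[%classic) = (c < y).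
  by apply/idP/idP; rewrite inE/= in_itv/= andbT.
rewrite !inI; case: ifP => vs; last by rewrite mulr0 mul0r.
(* Beyond [atanh |v|], [s] is positive, so the indicator of the positive half-line is 1. *)
by rewrite (le_lt_trans (atanh_ge0 v01) vs) !mul1r mulr1.
Qed.

End velocity_law.

(** * Rescaling to the unit interval and the normalizing constant *)

Section beta_law.
Context {R : realType}.
Local Notation mu := (@lebesgue_measure R).

(** Under [v = 2 * x - 1] one has [1 - v ^+ 2 = 4 * x * (1 - x)]; the power [gamma / 2 - 1] of 4 and
    the Jacobian 2 combine into the power [gamma - 1] of 2. *)
Lemma integral_velocity_weight (gamma : R) (B : set R) :
  2 < gamma -> measurable B ->
  (\int[mu]_(v in B) (velocity_weight gamma v)%:E =
   (2 `^ (gamma - 1))%:E *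
   \int[mu]_(x in `[0%R, 1%R] `&` [set x | B (2 * x - 1)%R])
     (x `^ (gamma / 2 - 1) * (1 - x) `^ (gamma / 2 - 1))%:E)%E.
Proof.
move=> g2 mB; set p := gamma / 2 - 1.
have mw := measurable_velocity_weight gamma.
have w0 := velocity_weight_ge0 gamma.
have d2 (x : R) : is_derive x 1 (fun x : R => 2 * x - 1) 2.
  rewrite -[X in is_derive _ _ _ X]subr0.
  by have := is_deriveB (is_derive_mulrl 2 x) (is_derive_cst (1 : R) x 1).
have c2 : continuous (fun x : R => 2 * x - 1).
  by move=> x; apply/differentiable_continuous/derivable1_diffP; case: (d2 x).
have mB2 : measurable ([set x | B (2 * x - 1)] : set R).
  rewrite -[X in measurable X]setTI.
  exact: (continuous_measurable_fun c2 measurableT mB).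
pose h (v : R) : \bar R := ((\1_B v)%:E * (velocity_weight gamma v)%:E)%E.
have mh : measurable_fun setT h.
  apply: emeasurable_funM; apply/measurable_EFinP; last exact: mw.
  exact: measurable_indic.
have h0 v : (0 <= h v)%E by rewrite mule_ge0// lee_fin.
transitivity (\int[mu]_(v in `[(2 * 0 - 1)%R, (2 * 1 - 1)%R]) h v)%E.
  rewrite integral_indicM [RHS]integral_indicM; apply: eq_integral => v _.
  rewrite /h /velocity_weight !indicE muleA.
  have -> : (v \in `[(2 * 0 - 1)%R, (2 * 1 - 1)%R]%classic) = (-1 <= v <= 1).
    by apply/idP/idP; rewrite inE/= in_itv/= mulr0 sub0r (_ : 2 * 1 - 1 = 1) //; ring.
  by case: ifP; rewrite ?mul1e ?mule0.
rewrite -(@ge0_integral_substitution_increasing _ (fun x => 2 * x - 1) (cst 2))//;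
  last by move=> x; exact: cst_continuous.
have mI : measurable (`[0, 1]%classic `&` [set x | B (2 * x - 1)] : set R).
  exact: measurableI.
rewrite -ge0_integralZl_EFin//; last 2 first.
- by move=> x _; rewrite lee_fin mulr_ge0// powR_ge0.
- apply: measurable_funTS; apply/measurable_EFinP/measurable_funM;
    apply: measurable_powRf => //; exact: measurable_funB.
rewrite integral_indicM [RHS]integral_indicM; apply: eq_integral => x _.
rewrite !indicE in_setI.
case: (boolP (x \in `[0, 1]%classic)) => [|_]; last by rewrite !mul0e.
rewrite inE/= in_itv/= => /andP[x0 x1]; rewrite !mul1e /h indicE.
have -> : (2 * x - 1 \in B) = (x \in [set x | B (2 * x - 1)]).
  by apply/idP/idP; rewrite !inE.
case: (boolP (_ \in _)) => _; last by rewrite !mul0e.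
rewrite !mul1e /velocity_weight ifT; last by apply/andP; split; lra.
rewrite -!EFinM; congr _%:E.
rewrite (_ : 1 - (2 * x - 1) ^+ 2 = (2 ^+ 2 * x) * (1 - x)); last by ring.
have q0 : 0 <= 2 ^+ 2 * x by rewrite mulr_ge0// exprn_ge0.
have x10 : 0 <= 1 - x by rewrite subr_ge0.
have q4 : 0 <= 2 ^+ 2 :> R by exact: exprn_ge0.
rewrite -/p (powRM p q0 x10) (powRM p q4 x0).
have -> : (2 ^+ 2 : R) `^ p = 2 `^ (2%:R * p) by rewrite powRrM powR_mulrn.
rewrite (_ : gamma - 1 = 2%:R * p + 1); last by rewrite /p; lra.
by rewrite (@powRD _ 2 (2%:R * p) 1) ?pnatr_eq0 ?implybT// powRr1//; ring.
Qed.

(** The beta integral is [gamma_integralM] at [a = b = gamma / 2]; the total mass then follows from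
    [integral_velocity_weight] on the whole line. *)
Lemma velocity_weight_normalization (gamma : R) : 2 < gamma ->
  [/\ 0 < Gamma gamma, 0 < Gamma (gamma / 2),
   \int[mu]_(y in `[0, 1]) (y `^ (gamma / 2 - 1) * (1 - y) `^ (gamma / 2 - 1)) =
     Gamma (gamma / 2) ^+ 2 / Gamma gamma &
   (\int[mu]_v (velocity_weight gamma v)%:E =
    (2 `^ (gamma - 1) * Gamma (gamma / 2) ^+ 2 / Gamma gamma)%:E)%E].
Proof.
move=> g2.
have a1 : 1 < gamma / 2 by rewrite ltr_pdivlMr// mul1r.
have g1 : 1 < gamma by rewrite (lt_trans _ g2)// ltr1n.
(* [Gamma] is the real part extracted from [gamma_integral], which loses nothing once the latter is
   finite. *)
have GE (a : R) : 1 < a -> (gamma_integral a = (Gamma a)%:E)%E.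
  move=> ha; rewrite /Gamma /Rintegral fineK//.
  rewrite ge0_fin_numE ?gamma_integral_lty//.
  exact/ltW/gamma_integral_gt0.
have G0 (a : R) : 1 < a -> 0 < Gamma a.
  by move=> ha; rewrite -lte_fin -GE// gamma_integral_gt0.
have GG := G0 _ g1; have Gh := G0 _ a1.
have bE : (beta_integral (gamma / 2) (gamma / 2) =
    (Gamma (gamma / 2) ^+ 2 / Gamma gamma)%:E)%E.
  have := gamma_integralM (gamma / 2) (gamma / 2).
  rewrite -splitr !GE// => H.
  have inv : ((Gamma gamma)^-1%:E * (Gamma gamma)%:E = 1)%E.
    by rewrite -EFinM mulVf// gt_eqF.
  by rewrite -[LHS]mul1e -inv -muleA -H -!EFinM expr2 mulrC.
split=> //; first by rewrite /Rintegral -/(beta_integral _ _) bE.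
rewrite integral_velocity_weight// setIT -/(beta_integral _ _) bE -EFinM.
by rewrite mulrA.
Qed.

End beta_law.

(** * The law of a velocity component at time [t] *)

Theorem corollary5p6 (R : realType) (gamma : R) (hgamma : 2 < gamma)
    (d : measure_display) (Omega : measurableType d) (P : probability Omega R)
    (W S : R -> Omega -> R) (Theta : R -> Omega -> R3 R)
    (hOU : is_relativistic_OU P gamma W S Theta)
    (mu : probability (R * R3 R)%type R)
    (hmu : is_invariant_probability gamma mu)
    (t : R) (ht : 0 <= t) (hlaw : has_law P (state S Theta t) mu)
    (i : 'I_3) :
  has_law P (fun w => component i (velocity S Theta t w))
    (symmetric_beta_law (gamma / 2)) /\
  has_density P (fun w => component i (velocity S Theta t w))
    (fun v => if -1 <= v <= 1 then
       Gamma gamma / (2 `^ (gamma - 1) * Gamma (gamma / 2) ^+ 2) *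
       (1 - v ^+ 2) `^ (gamma / 2 - 1) else 0).
Proof.
have [] := velocity_weight_normalization hgamma.
(* The Gamma values become arbitrary positive reals linked by [bE] and [wE]. *)
move: (Gamma gamma) (Gamma (gamma / 2)) => G H G0 H0 bE wE.
case: hmu => c [c0 muE]; case: hlaw => mstate lawE.
set C := G / _.
have VE w : component i (velocity S Theta t w) =
    tanh (state S Theta t w).1 * component i (state S Theta t w).2.
  by case: i => [[|[|[|//]]]].
have mV : measurable_fun setT (fun w => component i (velocity S Theta t w)).
  rewrite (_ : (fun w => _) = (fun p : R * R3 R => tanh p.1 * component i p.2)
    \o state S Theta t); last exact/funext.
  exact: (measurableT_comp (measurable_velocity i)).
pose K := c * (2 * pi / (gamma - 2)).
have lawVE (B : set R) : measurable B ->
    P ((fun w => component i (velocity S Theta t w)) @^-1` B) =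
    (K%:E * \int[lebesgue_measure]_(v in B) (velocity_weight gamma v)%:E)%E.
  move=> mB.
  have mA : measurable [set p : R * R3 R | B (tanh p.1 * component i p.2)].
    by rewrite -[X in measurable X]setTI; exact: measurable_velocity.
  rewrite EFinM -muleA -(invariant_weight_velocity i hgamma mB) -muE// -lawE//.
  by congr (P _); apply/funext => w /=; rewrite VE.
have p0 : 0 < 2 `^ (gamma - 1) :> R by exact: powR_gt0.
(* On the whole line, the total mass 1 fixes [K] without any computation of [c]. *)
have KE : K = C.
  have := lawVE setT measurableT; rewrite preimage_setT probability_setT wE.
  rewrite -EFinM => /eqP; rewrite eqe => /eqP K1.
  by rewrite -[RHS]mulr1 K1 /C; field; rewrite !gt_eqF.
have mw := measurable_velocity_weight gamma.
have w0 := velocity_weight_ge0 gamma.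
have C0 : 0 <= C by rewrite divr_ge0 ?mulr_ge0 ?exprn_ge0// ltW.
have -> : (fun v : R => if -1 <= v <= 1 then
    C * (1 - v ^+ 2) `^ (gamma / 2 - 1) else 0) =
    (fun v => C * velocity_weight gamma v).
  by apply/funext => v; rewrite /velocity_weight; case: ifP; rewrite ?mulr0.
split; last split.
(* The power of 2 from the rescaling cancels the one in [C], which leaves [G / H ^+ 2], the inverse
   of the beta integral. *)
- split=> // B mB; rewrite lawVE// KE integral_velocity_weight//.
  rewrite /symmetric_beta_law /Defs.beta_pdf bE muleA -EFinM.
  have mB2 : measurable (`[0, 1]%classic `&` [set x | B (2 * x - 1)] : set R).
    apply: measurableI => //; rewrite -[X in measurable X]setTI.
    have m2 : measurable_fun setT (fun x : R => 2 * x - 1).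
      by apply: measurable_funB => //; exact: measurable_funM.
    exact: (m2 measurableT _ mB).
  rewrite -ge0_integralZl_EFin//; last 3 first.
  + by move=> x _; rewrite lee_fin mulr_ge0// powR_ge0.
  + apply: measurable_funTS; apply/measurable_EFinP/measurable_funM;
      apply: measurable_powRf => //; exact: measurable_funB.
  + by rewrite mulr_ge0// ltW.
  apply: eq_integral => x _; rewrite -EFinM /C; congr _%:E; field.
  by rewrite !gt_eqF.
- exact: measurable_funM.
- by move=> v; rewrite mulr_ge0.
- split=> // B mB; rewrite lawVE// KE.
  under [in RHS]eq_integral do rewrite EFinM.
  rewrite ge0_integralZl_EFin//.
  + by move=> v _; rewrite lee_fin.
  + by apply: measurable_funTS; exact/measurable_EFinP.
Qed.
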